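(* Let $N\ge 1$ be an integer, $s\in(0,1)$, $q\in(1,2)$, and let $\Omega\subset\mathbb{R}^N$ be a bounded open set with $C^{1,1}$ boundary. Then $\lambda_1(\Omega,s,q)$ is isolated, i.e., there exists no sequence of $q$-semilinear $s$-eigenvalues of $\Omega$, all different from $\lambda_1(\Omega,s,q)$, converging to $\lambda_1(\Omega,s,q)$.
   Context: For a function $u$ on $\mathbb{R}^N$ write $[u]^2=\int_{\mathbb{R}^N}\int_{\mathbb{R}^N}\frac{(u(x)-u(y))^2}{|x-y|^{N+2s}}\,dx\,dy$. Functions in $C_0^\infty(\Omega)$ (smooth, compactly supported in $\Omega$) are extended by $0$ to $\mathbb{R}^N\setminus\Omega$. $\mathcal{D}^{s,2}_0(\Omega)$ is the completion of $C_0^\infty(\Omega)$ with respect to the norm $[\cdot]$. $\lambda_1(\Omega,s,q)=\inf\{[\varphi]^2:\varphi\in C_0^\infty(\Omega),\ \int_\Omega|\varphi|^q\,dx=1\}$; for bounded $\Omega$ and $q\in(1,2)$ this is positive and $\mathcal{D}^{s,2}_0(\Omega)$ is identified with a space of functions continuously embedded in $L^q(\Omega)$, extended by $0$ outside $\Omega$. A number $\lambda>0$ is a $q$-semilinear $s$-eigenvalue of $\Omega$ (a constrained critical value of $[\cdot]^2$ along $\{u\in\mathcal{D}^{s,2}_0(\Omega):\int_\Omega|u|^q\,dx=1\}$) if there is a non-trivial $u\in\mathcal{D}^{s,2}_0(\Omega)$ with $$\int_{\mathbb{R}^N}\int_{\mathbb{R}^N}\frac{(u(x)-u(y))(\varphi(x)-\varphi(y))}{|x-y|^{N+2s}}\,dx\,dy=\lambda\|u\|_{L^q(\Omega)}^{2-q}\int_\Omega|u|^{q-2}u\,\varphi\,dx\quad\text{for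 all }\varphi\in\mathcal{D}^{s,2}_0(\Omega).$$ *)

(* Defs.v *)
From HB Require Import structures.
From mathcomp Require Import all_boot all_order all_algebra.
From mathcomp Require Import all_classical all_reals all_analysis.

Set Implicit Arguments.
Unset Strict Implicit.
Unset Printing Implicit Defensive.

Import Order.TTheory GRing.Theory Num.Theory.
Import numFieldNormedType.Exports.

Local Open Scope classical_set_scope.
Local Open Scope ring_scope.

(** * Lebesgue measure on R^N *)

(* R^N is ['rV[R]_N], with the sigma-algebra generated by the coordinates,
   i.e. the product (= Borel) sigma-algebra. *)
Section measurable_rV.
Context {R : realType} (n : nat).

Let coors (i : 'I_n) (x : 'rV[R]_n) : measurableTypeR R := x ord0 i.

Let rV_set0 : g_sigma_preimage coors set0.
Proof. exact: sigma_algebra0. Qed.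

Let rV_setC A : g_sigma_preimage coors A -> g_sigma_preimage coors (~` A).
Proof. exact: sigma_algebraC. Qed.

Let rV_bigcup (F : _^nat) : (forall i, g_sigma_preimage coors (F i)) ->
  g_sigma_preimage coors (\bigcup_i (F i)).
Proof. exact: sigma_algebra_bigcup. Qed.

HB.instance Definition _ := @isMeasurable.Build
  (measure_tuple_display default_measure_display) 'rV[R]_n (g_sigma_preimage coors) rV_set0 rV_setC rV_bigcup.

End measurable_rV.

Section rV_cons.
Context {R : realType}.

Lemma measurable_coord n (i : 'I_n) :
  measurable_fun setT (fun x : 'rV[R]_n => x ord0 i : measurableTypeR R).
Proof.
move=> _ Y mY; rewrite setTI; apply: sub_sigma_algebra => /=.
rewrite -bigcup_seq/=; exists i => /=; first by rewrite mem_index_enum.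
by exists Y => //; rewrite setTI.
Qed.

Lemma measurable_fun_rV d (T : measurableType d) n (f : T -> 'rV[R]_n) :
  (forall i, measurable_fun setT (fun x => f x ord0 i : measurableTypeR R)) ->
  measurable_fun setT f.
Proof.
move=> mf _ A mA; rewrite setTI; move: A mA.
suff : @measurable _ 'rV[R]_n `<=`
    [set A | measurable (f @^-1` A)] by move=> h A /h.
apply: smallest_sub.
  split => /=.
  - by rewrite preimage_set0.
  - by move=> A mA; rewrite setTD preimage_setC; exact: measurableC.
  - by move=> F mF; rewrite preimage_bigcup; exact: bigcup_measurable.
rewrite -bigcup_seq/=; apply: bigcup_sub => i _ _ [B mB <-] /=.
by rewrite setTI -[X in measurable X]setTI; exact: (mf i measurableT _ mB).
Qed.

Definition rV_cons n (p : measurableTypeR R * 'rV[R]_n) : 'rV[R]_n.+1 :=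
  \row_i oapp (p.2 ord0) p.1 (unlift ord0 i).

Lemma measurable_rV_cons n : measurable_fun setT (@rV_cons n).
Proof.
apply: measurable_fun_rV => i.
under eq_fun do rewrite /rV_cons mxE.
case: unliftP => [j _|_] /=; last exact: measurable_fst.
by apply: (measurableT_comp (measurable_coord j)); exact: measurable_snd.
Qed.

Lemma rV_consK n (x : 'rV[R]_n.+1) :
  rV_cons (x ord0 ord0, \row_j x ord0 (lift ord0 j)) = x.
Proof.
apply/rowP => i; rewrite mxE /=.
by case: unliftP => [j ->|->] //=; rewrite mxE.
Qed.

End rV_cons.

Section lebesgue_rV_step.
Context {R : realType} (n : nat).
Variable mu : {sigma_finite_measure set 'rV[R]_n -> \bar R}.
Local Open Scope ereal_scope.

Definition lebesgue_rV_step : set 'rV[R]_n.+1 -> \bar R :=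
  pushforward (@lebesgue_measure R \x mu) (@rV_cons R n).

Let step_measure : {measure set 'rV[R]_n.+1 -> \bar R} :=
  measure_function_pushforward__canonical__measure_function_Measure
    (@lebesgue_measure R \x mu) (@measurable_rV_cons R n).

HB.instance Definition _ := Measure.copy lebesgue_rV_step step_measure.

Let step_sigma_finite : sigma_finite setT lebesgue_rV_step.
Proof.
have /sigma_finiteP[F [TF ndF Foo]] := sigma_finiteT (@lebesgue_measure R).
have /sigma_finiteP[G [TG ndG Goo]] := sigma_finiteT mu.
pose g (x : 'rV[R]_n.+1) : measurableTypeR R * 'rV[R]_n :=
  (x ord0 ord0, \row_j x ord0 (lift ord0 j)).
have mg : measurable_fun setT g.
  apply/measurable_fun_pair; first exact: measurable_coord.
  apply: measurable_fun_rV => i.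
  under eq_fun do rewrite mxE.
  exact: measurable_coord.
have gK : cancel (@rV_cons R n) g.
  move=> [x y]; rewrite /g /rV_cons !mxE unlift_none /=; congr pair.
  by apply/rowP => j; rewrite !mxE liftK.
exists (fun k => g @^-1` (F k `*` G k)).
  rewrite predeqE => x; split=> [_|//].
  have [k _ Fk] : (\bigcup_k F k) (g x).1 by rewrite -TF.
  have [l _ Gl] : (\bigcup_k G k) (g x).2 by rewrite -TG.
  exists (maxn k l) => //; split.
  - by move: Fk; exact/subsetPset/ndF/leq_maxl.
  - by move: Gl; exact/subsetPset/ndG/leq_maxr.
move=> k; have [mF muF] := Foo k; have [mG muG] := Goo k; split.
  by rewrite -[X in measurable X]setTI; apply: mg => //; exact: measurableX.
rewrite /lebesgue_rV_step /pushforward -comp_preimage.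
rewrite (_ : g \o _ = id); last by apply/funext => x /=; rewrite gK.
by rewrite preimage_id product_measure1E// lte_mul_pinfty// ge0_fin_numE.
Qed.

HB.instance Definition _ :=
  Measure_isSigmaFinite.Build _ _ _ lebesgue_rV_step step_sigma_finite.

End lebesgue_rV_step.

(* The N-fold product of the Lebesgue measure on R; on R^0 it is the Dirac mass
   at the unique point. *)
Fixpoint lebesgue_rV {R : realType} (n : nat) :
    {sigma_finite_measure set 'rV[R]_n -> \bar R} :=
  match n return {sigma_finite_measure set 'rV[R]_n -> \bar R} with
  | 0%N => \d_(0 : 'rV[R]_0)
  | m.+1 => lebesgue_rV_step (@lebesgue_rV R m)
  end.

Lemma lebesgue_rV_box {R : realType} n (A : 'I_n -> set (measurableTypeR R)) :
  (forall i, measurable (A i)) ->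
  lebesgue_rV n [set x | forall i, A i (x ord0 i)]
  = (\prod_(i < n) lebesgue_measure (A i))%E.
Proof.
elim: n A => [|n IH] A mA.
  rewrite big_ord0 /= diracE mem_set //= => -[].
  by case.
rewrite big_ord_recl /= -IH // /lebesgue_rV_step /pushforward.
rewrite (_ : _ @^-1` _ =
    A ord0 `*` [set x : 'rV[R]_n | forall i, A (lift ord0 i) (x ord0 i)]).
  rewrite product_measure1E //.
  rewrite (_ : [set _ | _] = \bigcap_(i : 'I_n)
      ((fun x : 'rV[R]_n => x ord0 i : measurableTypeR R) @^-1` A (lift ord0 i))).
    apply: fin_bigcap_measurable => // i _.
    by rewrite -[X in measurable X]setTI; exact: measurable_coord.
  by apply/seteqP; split => x /= h i; [move=> _; exact: h|exact: h].
apply/seteqP; split => -[x y] /=.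
  move=> h; split => [|i].
    by have := h ord0; rewrite mxE unlift_none.
  by have := h (lift ord0 i); rewrite mxE liftK.
move=> [hx hy] i; rewrite mxE /=.
by case: unliftP => [j ->|->] //=.
Qed.

(** * Test functions and domains *)

(* The norm [`|x|] of the library on ['rV[R]_N] is the sup norm. *)
Definition euclidean_norm {R : realType} {N : nat} (x : 'rV[R]_N) : R :=
  Num.sqrt (\sum_(i < N) x ord0 i ^+ 2).

Section smoothness.
Context {R : realType} {N : nat}.
Implicit Types (f g : 'rV[R]_N -> R) (Omega : set 'rV[R]_N).

Definition partial_derivative f (i : 'I_N) : 'rV[R]_N -> R :=
  fun x => 'D_(delta_mx ord0 i) f x.

Definition gradient f (x : 'rV[R]_N) : 'rV[R]_N :=
  \row_i partial_derivative f i x.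

Definition iterated_partial f (w : seq 'I_N) : 'rV[R]_N -> R :=
  foldl partial_derivative f w.

Definition smooth f : Prop := forall w : seq 'I_N,
  continuous (iterated_partial f w) /\
  forall (i : 'I_N) x, derivable (iterated_partial f w) x (delta_mx ord0 i).

(* The space C_0^oo(Omega), each function being already extended by 0 to R^N:
   the extension by 0 of a smooth function with compact support in Omega is
   smooth on R^N. *)
Definition test_function Omega f : Prop :=
  [/\ smooth f, compact (closure [set x | f x != 0])
    & closure [set x | f x != 0] `<=` Omega].

Definition C11 g : Prop :=
  (forall x, differentiable g x) /\
  exists L : R, L.-lipschitz (gradient g).

End smoothness.

(* Near each of its boundary points, in suitable orthonormal coordinates
   [y := x *m Q], Omega is the open region below the graph of a C^{1,1} function
   of the N-1 coordinates other than the [i]-th one. *)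
Definition C11_boundary {R : realType} {N : nat} (Omega : set 'rV[R]_N) : Prop :=
  forall x0, (closure Omega `\` interior Omega) x0 ->
  exists (r : R) (Q : 'M[R]_N) (i : 'I_N) (g : 'rV[R]_N.-1 -> R),
    [/\ 0 < r, Q *m Q^T = 1%:M, C11 g &
      forall x, euclidean_norm (x - x0) < r ->
        (Omega x <-> (x *m Q) ord0 i < g (col' i (x *m Q)))].

(** * The fractional Sobolev space and the eigenvalue problem *)

Section fractional_eigenvalues.
Context {R : realType} {N : nat}.
Implicit Types (Omega : set 'rV[R]_N) (u v phi : 'rV[R]_N -> R) (s q : R).
Local Open Scope ereal_scope.

Local Notation leb := (@lebesgue_rV R N).

(* Under the conventions [0^-1 = 0] and [0 `^ p = 0] for [p != 0], the integrand
   is 0 on the (negligible) diagonal. *)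
Definition gagliardo_form s u v : \bar R :=
  \int[leb \x leb]_z
    ((u z.1 - u z.2) * (v z.1 - v z.2)
       / euclidean_norm (z.1 - z.2) `^ (N%:R + 2 * s))%R%:E.

(* [u]^2 *)
Definition gagliardo_sq s u : \bar R :=
  \int[leb \x leb]_z
    ((u z.1 - u z.2) ^+ 2
       / euclidean_norm (z.1 - z.2) `^ (N%:R + 2 * s))%R%:E.

Definition Lq_norm Omega q u : \bar R :=
  'N[leb]_(q%:E)[(EFin \o u) \_ Omega].

(* The completion of C_0^oo(Omega) for the norm [.], realized as a space of
   functions through the embedding into L^q(Omega): the class of a Cauchy
   sequence for [.] is identified with the limit of that sequence in
   L^q(Omega), extended by 0. Elements of the space are Borel representatives
   vanishing everywhere outside Omega. *)
Definition D0s2 Omega s q : set ('rV[R]_N -> R) :=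
  [set u | [/\ measurable_fun setT (u : 'rV[R]_N -> measurableTypeR R),
     (forall x, ~ Omega x -> u x = 0%R) &
     exists phi : nat -> 'rV[R]_N -> R,
     [/\ forall n, test_function Omega (phi n),
         forall e : R, (0 < e)%R -> exists n0, forall m n,
           (n0 <= m)%N -> (n0 <= n)%N ->
           gagliardo_sq s (phi m \- phi n)%R < (e ^+ 2)%:E &
         Lq_norm Omega q (phi n \- u)%R @[n --> \oo] --> 0]]].

Definition lambda1 Omega s q : \bar R :=
  ereal_inf [set gagliardo_sq s phi | phi in
    [set phi | test_function Omega phi /\
               \int[leb]_(x in Omega) (`|phi x| `^ q)%:E = 1]].

Definition semilinear_eigenvalue Omega s q (lambda : R) : Prop :=
  (0 < lambda)%R /\
  exists u, [/\ D0s2 Omega s q u,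
    ~ (u = cst 0%R %[ae leb]) &
    forall phi, D0s2 Omega s q phi ->
      gagliardo_form s u phi =
      lambda%:E * Lq_norm Omega q u `^ (2 - q) *
      \int[leb]_(x in Omega) (`|u x| `^ (q - 2) * u x * phi x)%R%:E].

End fractional_eigenvalues.

(* Main.v *)
Require Import Defs.
From mathcomp Require Import all_boot all_order all_algebra ring lra.
From mathcomp Require Import all_classical all_reals all_analysis measurable_realfun.

Set Implicit Arguments.
Unset Strict Implicit.
Unset Printing Implicit Defensive.

Import Order.TTheory GRing.Theory Num.Theory.
Import numFieldNormedType.Exports.

Local Open Scope classical_set_scope.
Local Open Scope ring_scope.

(* The energy is nonlocal, so the positive and negative parts of a function u interact:
   [u]^2 exceeds [|u|]^2 by 8 times the integral of u^+(x) u^-(y) / |x-y|^(N+2s), and on a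
   bounded domain the kernel is bounded below.  If u is normalized in L^q and is an
   eigenfunction for lam close to lambda_1, then [|u|]^2 >= lambda_1 bounds the product of
   the L^1-norms of u^+ and u^- by a multiple of lam - lambda_1, while the L^1-norm of u stays
   away from 0; so, up to a sign, v = u^- is small in L^1.  Testing the equation with v gives
     [v]^2 + c |v|_1 <= lam |v|_q^q,
   where the second term on the left is again the interaction with u^+.  As q > 1, the part of
   |v|_q^q on {v <= tau} is absorbed by c |v|_1; the rest lives on a set of small measure and
   is absorbed by [v]^2, thanks to a Poincare inequality whose constant degenerates with the
   measure of the support.  Hence v = 0 and u >= 0.  Finally, testing with phi^2 / (u + e),
   Picone's inequality and Young's inequality (here q < 2) give lam <= [phi]^2 for every
   competitor phi, so lam = lambda_1. *)

(** * Dominated convergence with varying dominating functions *)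

(** The equation can be tested only with elements of the completion, and |u|, the negative part of u
    and phi^2 / (u + e) are not known to lie there. Each is instead an almost everywhere limit of
    test functions, built by smooth Lipschitz operations from a sequence phi_n approximating u, and
    the equation passes to the limit. No fixed majorant is available; the majorants involve the
    energy densities of phi_n, whose integrals converge, hence the generalized dominated
    convergence. The constants are fixed in the order c, tau, r, d: c bounds the L^1-norm from
    below, tau makes lam tau^(q-1) at most the coefficient of the L^1-term, r makes the Poincare
    constant large enough, and d makes the support of the truncated negative part small enough for
    that r. None depends on the eigenfunction. The final use of Young's inequality divides by u, so
    phi must vanish where u does. This is drawn from the remainder in Picone's inequality and the
    lower bound of the kernel, not from regularity of u. *)

Definition Rintegrable {d} {T : measurableType d} {R : realType}
    (mu : {measure set T -> \bar R}) (f : T -> R) :=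
  mu.-integrable setT (EFin \o f).

Lemma cvg_minr {R : realType} (f g : nat -> R) (a b : R) :
  f @ \oo --> a -> g @ \oo --> b -> (fun n => Num.min (f n) (g n)) @ \oo --> Num.min a b.
Proof. by move=> fa gb; apply: continuous2_cvg fa gb; exact: (@min_continuous _ R (a, b)). Qed.

Lemma cvg_maxr {R : realType} (f g : nat -> R) (a b : R) :
  f @ \oo --> a -> g @ \oo --> b -> (fun n => Num.max (f n) (g n)) @ \oo --> Num.max a b.
Proof. by move=> fa gb; apply: continuous2_cvg fa gb; exact: (@max_continuous _ R (a, b)). Qed.

Lemma cvg0_le {R : realType} (a b : nat -> R) :
  (forall n, `|a n| <= b n) -> b @ \oo --> (0 : R) -> a @ \oo --> (0 : R).
Proof.
move=> ab b0; apply/norm_cvg0P.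
have c0 : (fun=> 0 : R) @ \oo --> (0 : R) by exact: cvg_cst.
apply: (squeeze_cvgr _ c0 b0).
by apply: nearW => n; rewrite /= ab normr_ge0.
Qed.

Lemma cvg_sub0 {R : realType} (a b : nat -> R) (l : R) :
  (fun n => a n - b n) @ \oo --> (0 : R) -> b @ \oo --> l -> a @ \oo --> l.
Proof.
move=> ab bl; rewrite -[l]add0r.
have -> : a = (fun n => a n - b n) \+ b by apply/funext => n /=; rewrite subrK.
exact: cvgD.
Qed.

Lemma cvg_subC {R : realType} (a : nat -> R) (l : R) :
  a @ \oo --> l -> (fun n => a n - l) @ \oo --> (0 : R).
Proof. by move=> al; rewrite -(subrr l); apply: cvgB => //; exact: cvg_cst. Qed.

Lemma cvg0_small {R : realType} (a : nat -> R) (e : R) : a @ \oo --> (0 : R) ->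
  0 < e -> exists N, forall n, (N <= n)%N -> `|a n| < e.
Proof.
move=> /cvgrPdist_lt /[apply] -[N _ HN]; exists N => n /HN /=.
by rewrite sub0r normrN.
Qed.

(** Clipping at level b moves g by the excess of |g| over b, which is at most (c - a)^+ because
    [a <= b]. This positive part is written with [Num.min] so that it can be integrated term by
    term. *)
Lemma clip_dist {R : realType} (g a b c : R) : - b <= a -> a <= b -> 0 <= b ->
  `|g| <= c ->
  `|g - Num.max (- b) (Num.min g b)| <= c - a - Num.min (c - a) 0.
Proof.
rewrite !ler_norml => ? ? ? /andP[? ?].
have [h1|h1] := leP g b; last first.
  have [] := leP (- b) b; have [] := leP (c - a) 0 => *; apply/andP; split; lra.
by have [] := leP (- b) g; have [] := leP (c - a) 0 => *; apply/andP; split; lra.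
Qed.

Section real_integral.
Context d (T : measurableType d) (R : realType) (mu : {measure set T -> \bar R}).
Implicit Types f g : T -> R.
Local Notation L1 := (Rintegrable mu).

Lemma Rintegrable_measurable f : L1 f -> measurable_fun setT f.
Proof. by move=> /measurable_int /measurable_EFinP. Qed.

Lemma RintegrableD f g : L1 f -> L1 g -> L1 (fun x => f x + g x).
Proof. by move=> fi gi; exact: (integrableD measurableT fi gi). Qed.

Lemma RintegrableB f g : L1 f -> L1 g -> L1 (fun x => f x - g x).
Proof. by move=> fi gi; exact: (integrableB measurableT fi gi). Qed.

Lemma RintegrableZ k f : L1 f -> L1 (fun x => k * f x).
Proof. by move=> fi; exact: (integrableZl measurableT k fi). Qed.

Lemma Rintegrable_le f g : measurable_fun setT f -> L1 g ->
  (forall x, `|f x| <= g x) -> L1 f.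
Proof.
move=> mf gi fg; apply: (le_integrable measurableT _ _ gi).
  exact/measurable_EFinP.
by move=> x _ /=; rewrite lee_fin (le_trans (fg x))// ler_norm.
Qed.

Lemma Rintegrable_norm f : L1 f -> L1 (fun x => `|f x|).
Proof. exact: integrable_norm. Qed.

Lemma Rintegral_fineK f : L1 f -> (\int[mu]_x (f x)%:E = (\int[mu]_x f x)%R%:E)%E.
Proof. by move=> fi; rewrite fineK//; exact: integrable_fin_num. Qed.

Lemma Rintegrable_ltP f : measurable_fun setT f -> (forall x, 0 <= f x) ->
  ((\int[mu]_x (f x)%:E)%E < +oo)%E -> L1 f.
Proof.
move=> mf f0 fi; apply/integrableP; split; first exact/measurable_EFinP.
by under eq_integral => x _ do rewrite /= ger0_norm//.
Qed.

Lemma Rint_le f g : L1 f -> L1 g -> (forall x, f x <= g x) ->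
  \int[mu]_x f x <= \int[mu]_x g x.
Proof. by move=> fi gi fg; exact: le_Rintegral. Qed.

Lemma Rint_D f g : L1 f -> L1 g ->
  \int[mu]_x (f x + g x) = \int[mu]_x f x + \int[mu]_x g x.
Proof. by move=> fi gi; exact: RintegralD. Qed.

Lemma Rint_B f g : L1 f -> L1 g ->
  \int[mu]_x (f x - g x) = \int[mu]_x f x - \int[mu]_x g x.
Proof. by move=> fi gi; exact: RintegralB. Qed.

Lemma Rint_Z k f : L1 f -> \int[mu]_x (k * f x) = k * \int[mu]_x f x.
Proof. by move=> fi; exact: RintegralZl. Qed.

Lemma Rintegrable_indic (A : set T) : measurable A -> (mu A < +oo)%E ->
  L1 (\1_A : T -> R).
Proof.
move=> mA fA; apply: Rintegrable_ltP => //.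
by rewrite integral_indic// setIT.
Qed.

Lemma ae_Rintegrable f g : L1 f -> measurable_fun setT g ->
  {ae mu, forall x, f x = g x} -> L1 g /\ \int[mu]_x g x = \int[mu]_x f x.
Proof.
move=> fi mg fg.
have mf := Rintegrable_measurable fi.
split.
  move/integrableP : fi => [_ fi]; apply/integrableP; split; first exact/measurable_EFinP.
  rewrite (_ : (\int[mu]_x _)%E = (\int[mu]_x `|(EFin \o f) x|)%E)//.
  apply: ae_eq_integral => //.
  - by apply/measurable_EFinP; apply: measurableT_comp.
  - by apply/measurable_EFinP; apply: measurableT_comp.
  - by apply: filterS fg => x /= -> _.
rewrite /Rintegral; congr fine; apply: ae_eq_integral => //; try exact/measurable_EFinP.
by apply: filterS fg => x /= -> _.
Qed.

Lemma ae_Rint_le f g : L1 f -> L1 g -> {ae mu, forall x, f x <= g x} ->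
  \int[mu]_x f x <= \int[mu]_x g x.
Proof.
move=> fi gi fg.
have mf := Rintegrable_measurable fi.
have mg := Rintegrable_measurable gi.
pose h x := Num.max (f x) (g x).
have mh : measurable_fun setT h by exact: measurable_maxr.
have [hi <-] : L1 h /\ \int[mu]_x h x = \int[mu]_x g x.
  by apply: ae_Rintegrable => //; apply: filterS fg => x /max_idPr.
by apply: Rint_le => // x; rewrite le_max lexx.
Qed.

Lemma Rint_eq0 f : L1 f -> (forall x, 0 <= f x) -> \int[mu]_x f x <= 0 ->
  {ae mu, forall x, f x = 0}.
Proof.
move=> fi f0 i0.
have : (\int[mu]_x `|(EFin \o f) x| = 0)%E.
  under eq_integral do rewrite /= ger0_norm//.
  rewrite Rintegral_fineK//; congr EFin; apply/eqP; rewrite eq_le i0/=.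
  exact: Rintegral_ge0.
move/(ae_eq_integral_abs mu measurableT (measurable_int _ fi)).
by apply: filterS => x /(_ I) [].
Qed.

Lemma Rdominated (f_ : nat -> T -> R) f g : (forall n, measurable_fun setT (f_ n)) ->
  measurable_fun setT f -> {ae mu, forall x, f_ ^~ x @ \oo --> f x} -> L1 g ->
  (forall n x, `|f_ n x| <= g x) ->
  L1 f /\ (fun n => \int[mu]_x f_ n x) @ \oo --> \int[mu]_x f x.
Proof.
move=> mf_ mf ff gi fg.
have := @dominated_convergence _ _ _ mu _ measurableT (fun n => EFin \o f_ n)
  (EFin \o f) (EFin \o g).
case=> //.
- by move=> n; exact/measurable_EFinP.
- exact/measurable_EFinP.
- by apply: filterS ff => x h _ /=; apply/fine_cvgP; split => //; exact: nearW.
- by apply: aeW => x n _ /=; rewrite lee_fin.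
move=> fi _ ffi; split=> //.
by apply: fine_cvg; rewrite fineK//; exact: integrable_fin_num.
Qed.

(* Clipping g_n to [-A, A] makes it dominated by A, at a cost in L^1 of at most
   the integral of (A_n - A)^+, which tends to 0. *)
Lemma Rdominated_var (g_ : nat -> T -> R) g (A_ : nat -> T -> R) (A : T -> R) :
  (forall n, measurable_fun setT (g_ n)) ->
  measurable_fun setT g -> {ae mu, forall x, g_ ^~ x @ \oo --> g x} ->
  (forall n, L1 (A_ n)) -> L1 A ->
  {ae mu, forall x, A_ ^~ x @ \oo --> A x} ->
  (forall n x, `|g_ n x| <= A_ n x) ->
  (fun n => \int[mu]_x A_ n x) @ \oo --> \int[mu]_x A x ->
  L1 g /\ (fun n => \int[mu]_x g_ n x) @ \oo --> \int[mu]_x g x.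
Proof.
move=> mg_ mg gg iA_ iA AA gA cA.
have mA_ n := Rintegrable_measurable (iA_ n).
have mA := Rintegrable_measurable iA.
have ig_ n : L1 (g_ n) by exact: (Rintegrable_le (mg_ n) (iA_ n)).
(* As [A_ n] is nonnegative, this is bounded by |A|: unlike [A_ n - A] it has a fixed majorant, and
   ordinary dominated convergence sends its integral to 0. *)
pose neg n x : R := Num.min (A_ n x - A x) 0.
have mneg n : measurable_fun setT (neg n).
  by apply: measurable_minr => //; exact: measurable_funB.
have A_0 n x : 0 <= A_ n x by exact: le_trans (gA n x).
(* [A] is nonnegative only almost everywhere, so |A| serves as clipping level. *)
pose B x : R := `|A x|.
have iB : L1 B by exact: Rintegrable_norm.
have B0 x : 0 <= B x by exact: normr_ge0.
have negB n x : `|neg n x| <= B x.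
  rewrite /neg; have := A_0 n x; have := B0 x; have : A x <= B x by exact: ler_norm.
  by rewrite ler_norml; have [] := leP (A_ n x - A x) 0 => ? ? ? ?; apply/andP; split; lra.
have [_] : L1 (cst 0) /\ (fun n => \int[mu]_x neg n x) @ \oo --> \int[mu]_x (cst 0 x : R).
  apply: (Rdominated (g := B)) => //.
  apply: filterS AA => x Ax.
  have h : (fun n => A_ n x - A x) @ \oo --> (0 : R).
    exact: cvg_subC.
  rewrite /neg /= -[X in _ --> X](minxx (0:R)).
  by apply: (cvg_minr h); exact: cvg_cst.
rewrite (_ : \int[mu]_x _ = 0); last first.
  by rewrite /Rintegral /= integral0.
move=> neg0.
have ineg n : L1 (neg n) by exact: (Rintegrable_le (mneg n) iB).
pose c n x : R := Num.max (- B x) (Num.min (g_ n x) (B x)).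
pose c' x : R := Num.max (- B x) (Num.min (g x) (B x)).
have mB := Rintegrable_measurable iB.
have mc n : measurable_fun setT (c n).
  apply: measurable_maxr; first exact: measurableT_comp.
  exact: measurable_minr.
have mc' : measurable_fun setT c'.
  apply: measurable_maxr; first exact: measurableT_comp.
  exact: measurable_minr.
have cB n x : `|c n x| <= B x.
  rewrite /c ler_norml; have := B0 x.
  have [h1|h1] := leP (g_ n x) (B x); last first.
    by have [] := leP (- B x) (B x) => *; apply/andP; split; lra.
  by have [] := leP (- B x) (g_ n x) => *; apply/andP; split; lra.
have [ic cc] : L1 c' /\ (fun n => \int[mu]_x c n x) @ \oo --> \int[mu]_x c' x.
  apply: (Rdominated (g := B)) => //.
  apply: filterS gg => x gx.
  apply: cvg_maxr; first exact: cvg_cst.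
  by apply: cvg_minr => //; exact: cvg_cst.
have [ig gc] : L1 g /\ \int[mu]_x g x = \int[mu]_x c' x.
  apply: ae_Rintegrable => //; apply: filterS2 gg AA => x gx Ax.
  have gAx : `|g x| <= A x.
    by apply: ler_cvg_to (cvg_norm gx) Ax _; exact: nearW.
  have : `|g x| <= B x by rewrite (le_trans gAx)// ler_norm.
  rewrite ler_norml => /andP[h1 h2].
  by rewrite /c' (min_idPl h2) (max_idPr h1).
split => //.
have icn n : L1 (c n) by exact: (Rintegrable_le (mc n) iB).
have key n : `|\int[mu]_x g_ n x - \int[mu]_x c n x| <=
   (\int[mu]_x A_ n x - \int[mu]_x A x) - \int[mu]_x neg n x.
  have iAA := RintegrableB (iA_ n) iA.
  rewrite -(Rint_B (ig_ n) (icn n)) -(Rint_B (iA_ n) iA) -(Rint_B iAA (ineg n)).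
  apply: le_trans (le_normr_Rintegral _ _) _ => //; first exact: RintegrableB.
  apply: Rint_le.
  - by apply: Rintegrable_norm; exact: RintegrableB.
  - by apply: RintegrableB => //; exact: RintegrableB.
  move=> x.
  have h1 : - B x <= A x by rewrite lerNl -[X in _ <= X]normrN ler_norm.
  have h2 : A x <= B x by rewrite ler_norm.
  exact: (clip_dist h1 h2 (B0 x) (gA n x)).
rewrite gc.
apply: (cvg_sub0 _ cc); apply: (cvg0_le key).
by rewrite -[X in _ --> X](subrr 0); apply: cvgB => //; exact: cvg_subC.
Qed.

(** Meant for perturbations v_n + u with v_n small: powers and energy densities are bounded by those
    of v_n, which vanish in the limit, plus those of u, which are fixed. *)
Lemma Rdominated_add (g_ h_ : nat -> T -> R) g h (C : R) :
  (forall n, measurable_fun setT (g_ n)) ->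
  measurable_fun setT g -> {ae mu, forall x, g_ ^~ x @ \oo --> g x} ->
  (forall n, L1 (h_ n)) -> L1 h -> {ae mu, forall x, h_ ^~ x @ \oo --> (0 : R)} ->
  (forall n x, `|g_ n x| <= C * (h_ n x + h x)) ->
  (fun n => \int[mu]_x h_ n x) @ \oo --> (0 : R) ->
  L1 g /\ (fun n => \int[mu]_x g_ n x) @ \oo --> \int[mu]_x g x.
Proof.
move=> mg_ mg gg ih_ ih hh gh ch.
apply: (Rdominated_var (A_ := fun n x => C * (h_ n x + h x)) (A := fun x => C * h x)) => //.
- by move=> n; exact: (RintegrableZ _ (RintegrableD (ih_ n) ih)).
- exact: RintegrableZ.
- apply: filterS hh => x hx; rewrite -[h x in X in _ --> X]add0r.
  by apply: cvgMr; apply: cvgD => //; exact: cvg_cst.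
- under eq_fun => n do rewrite (Rint_Z _ (RintegrableD (ih_ n) ih)) (Rint_D (ih_ n) ih).
  rewrite (Rint_Z _ ih) -[in C * \int[mu]_x h x](add0r (\int[mu]_x h x)).
  by apply: cvgMr; apply: cvgD => //; exact: cvg_cst.
Qed.

Lemma Rfatou (f_ : nat -> T -> R) f (C : R) : (forall n, L1 (f_ n)) -> (forall n x, 0 <= f_ n x) ->
  measurable_fun setT f -> {ae mu, forall x, f_ ^~ x @ \oo --> f x} ->
  (forall x, 0 <= f x) -> (\forall n \near \oo, \int[mu]_x f_ n x <= C) ->
  L1 f /\ \int[mu]_x f x <= C.
Proof.
move=> fi f0 mf ff f00 fC.
have mf_ n := Rintegrable_measurable (fi n).
suff h : ((\int[mu]_x (f x)%:E) <= C%:E)%E.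
  have fi' : L1 f by apply: Rintegrable_ltP => //; apply: le_lt_trans h (ltry _).
  by split => //; rewrite -lee_fin -Rintegral_fineK.
have -> : (\int[mu]_x (f x)%:E = \int[mu]_x limn_einf (fun n => (f_ n x)%:E))%E.
  apply: ae_eq_integral => //; first exact/measurable_EFinP.
    apply: measurableT_comp => //; apply: measurable_fun_limn_esup => n.
    by apply: measurableT_comp => //; exact/measurable_EFinP.
  apply: filterS ff => x fx _.
  have fx' : (fun n => (f_ n x)%:E) @ \oo --> (f x)%:E.
    by apply/fine_cvgP; split => //; exact: nearW.
  by have [-> _] := cvg_limn_einf_sup fx'.
apply: le_trans (fatou _ _ _ _) _ => //.
- by move=> n; exact/measurable_EFinP.
- by move=> n x _; rewrite lee_fin.
have [N _ HN] := fC.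
rewrite limn_einf_lim.
apply: lime_le.
  exact: is_cvg_einfs.
apply: nearW => n.
apply: ereal_inf_le => /=.
exists (\int[mu]_x (f_ (maxn n N) x)%:E)%E.
  by exists (maxn n N) => //=; exact: leq_maxl.
by rewrite Rintegral_fineK// lee_fin; apply: HN; exact: leq_maxr.
Qed.

(** Indices with integrals at most 2^-n make the sum of the chosen functions integrable, hence
    finite almost everywhere, so its terms tend to 0. [sigma] need not increase; [n <= sigma n]
    suffices to preserve limits. *)
Lemma ae_subseq (f_ : nat -> T -> R) : (forall n, L1 (f_ n)) -> (forall n x, 0 <= f_ n x) ->
  (fun n => \int[mu]_x f_ n x) @ \oo --> (0 : R) ->
  exists2 sigma : nat -> nat, (forall n, (n <= sigma n)%N) &
    {ae mu, forall x, (fun n => f_ (sigma n) x) @ \oo --> (0 : R)}.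
Proof.
move=> fi f0 f_0.
have mf_ n := Rintegrable_measurable (fi n).
have /choice[sigma hs] (n : nat) : exists m, (n <= m)%N /\ \int[mu]_x f_ m x <= 2^-1 ^+ n.
  have e0 : 0 < (2^-1 : R) ^+ n by rewrite exprn_gt0.
  have [N HN] := cvg0_small f_0 e0.
  exists (maxn n N); split; first exact: leq_maxl.
  exact: le_trans (ler_norm _) (ltW (HN _ (leq_maxr n N))).
exists sigma; first by move=> n; case: (hs n).
pose S x := (\sum_(n <oo) (f_ (sigma n) x)%:E)%E.
have S0 x : (0 <= S x)%E by apply: nneseries_ge0 => n _ _; rewrite lee_fin.
have mS : measurable_fun setT S.
  apply: ge0_emeasurable_sum => //.
  - by move=> n x _ _; rewrite lee_fin.
  - by move=> n _; exact/measurable_EFinP.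
have iS : mu.-integrable setT S.
  apply/integrableP; split => //.
  under eq_integral do rewrite gee0_abs//.
  rewrite integral_nneseries//; last 2 first.
  - by move=> n; exact/measurable_EFinP.
  - by move=> n x _; rewrite lee_fin.
  apply: (@le_lt_trans _ _ (\sum_(n <oo) ((2^-1 : R) ^+ n)%:E)%E).
    apply: lee_nneseries => n *; first by apply: integral_ge0 => x _; rewrite lee_fin.
    by rewrite Rintegral_fineK// lee_fin; case: (hs n).
  have c : series (fun n => (2^-1 : R) ^+ n) @ \oo --> ((1 - 2^-1)^-1 : R).
    have := @cvg_geometric_series R 1 2^-1.
    rewrite mul1r /geometric /=; under [X in series X]eq_fun do rewrite mul1r.
    by apply; rewrite ger0_norm//; lra.
  rewrite (_ : (\sum_(n <oo) _)%E = ((1 - 2^-1)^-1)%:E) ?ltry//.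
  apply/cvg_lim => //.
  rewrite [X in X @ _](_ : _ = EFin \o series (fun n => (2^-1 : R) ^+ n)).
    by apply: cvg_EFin => //; exact: nearW.
  by apply/funext => n; rewrite /series /= sumEFin.
have := integrable_ae measurableT iS.
apply: filterS => x /(_ I) Sx.
have c : (fun n => \sum_(0 <= k < n) (f_ (sigma k) x)%:E)%E @ \oo --> S x.
  by apply: is_cvg_nneseries => n *; rewrite lee_fin.
apply: cvg_series_cvg_0; apply/cvg_ex; exists (fine (S x)).
have c' : (fun n => \sum_(0 <= k < n) (f_ (sigma k) x)%:E)%E @ \oo --> (fine (S x))%:E.
  by rewrite fineK.
rewrite (_ : series _ = fine \o (fun n => \sum_(0 <= k < n) (f_ (sigma k) x)%:E)%E).
  exact: fine_cvg c'.
by apply/funext => n; rewrite /series /= sumEFin.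
Qed.

End real_integral.

(** * Smooth functions *)

(** Only a directional derivative of [f] is given, not differentiability, so [f] is restricted to
    the line [h *: v + x], where the one-variable chain rule applies. *)
Lemma is_derive_chain {R : realType} {V : normedModType R} (F : R -> R) (f : V -> R)
    (x v : V) (a b : R) :
  is_derive (f x) 1 F a -> is_derive x v f b -> is_derive x v (F \o f) (a * b).
Proof.
have lineE (g : V -> R) : 'D_v g x = 'D_1 (fun h : R => g (h *: v + x)) 0.
  rewrite /derive; set g1 := fun h => h^-1 *: _; set g2 := fun h => h^-1 *: _.
  suff -> : g1 = g2 by [].
  by apply/funext => h; rewrite /g1 /g2 /= addr0 scale0r add0r [_%:A]mulr1.
move=> Fa [fx fb].
pose l (h : R) := f (h *: v + x).
have l0 : l 0 = f x by rewrite /l scale0r add0r.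
have lb : is_derive (0 : R) 1 l b.
  by split; [exact/(derivable1P f x v).1|rewrite -lineE].
rewrite -l0 in Fa.
have [h1 h2] := is_derive1_comp Fa lb.
by split; [exact/derivable1P|rewrite lineE].
Qed.

Section smooth_algebra.
Context {R : realType} {N : nat}.
Implicit Types f g h : 'rV[R]_N -> R.
Local Notation e i := (delta_mx ord0 i : 'rV[R]_N).

(** Continuity of the partial derivatives is left out because [smooth_coind] asks [C1] of them in
    turn. *)
Definition C1 f := continuous f /\ forall i x, derivable f x (e i).

Lemma smooth_C1 f : smooth f -> C1 f.
Proof. by move=> sf; have [] := sf [::]. Qed.

Lemma smooth_partial f i : smooth f -> smooth (partial_derivative f i).
Proof. by move=> sf w; exact: (sf (i :: w)). Qed.

(** Smooth functions form the greatest class of [C1] functions stable under partial derivatives; one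
    stable class containing [f] replaces all computations of higher derivatives. *)
Lemma smooth_coind (P : set ('rV[R]_N -> R)) :
  (forall f, P f -> C1 f /\ forall i, P (partial_derivative f i)) ->
  forall f, P f -> smooth f.
Proof.
move=> hP f Pf w; elim: w f Pf => [|i w IH] f Pf /=; first by have [] := hP f Pf.
by apply: IH; have [] := hP f Pf.
Qed.

Inductive generated (G : set ('rV[R]_N -> R)) : set ('rV[R]_N -> R) :=
| gen_mem f : G f -> generated G f
| gen_cst c : generated G (fun=> c)
| gen_add f g : generated G f -> generated G g -> generated G (fun x => f x + g x)
| gen_mul f g : generated G f -> generated G g -> generated G (fun x => f x * g x).

(** By the Leibniz rule an algebra is stable under derivatives once the derivatives of its
    generators fall back into the algebra, not necessarily among the generators. *)
Lemma generated_smooth (G : set ('rV[R]_N -> R)) :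
  (forall f, G f -> C1 f /\ forall i, generated G (partial_derivative f i)) ->
  forall f, generated G f -> smooth f.
Proof.
move=> hG; apply: smooth_coind => f; elim=> {f} [f /hG//|c|f g gf [[cf df] pf] gg [[cg dg] pg]|
  f g gf [[cf df] pf] gg [[cg dg] pg]].
- split; first by split => [|i x]; [exact: cst_continuous|exact: derivable_cst].
  move=> i; rewrite (_ : partial_derivative _ _ = fun=> 0); first exact: gen_cst.
  by apply/funext => x; rewrite /partial_derivative derive_cst.
- split.
    by split=> [x|i x]; [apply: continuousD; [exact: cf|exact: cg]|exact: derivableD].
  move=> i; rewrite (_ : partial_derivative _ _ =
    fun x => partial_derivative f i x + partial_derivative g i x); first exact: gen_add.
  by apply/funext => x; rewrite /partial_derivative [LHS]deriveD.
- split.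
    by split=> [x|i x]; [apply: continuousM; [exact: cf|exact: cg]|exact: derivableM].
  move=> i; rewrite (_ : partial_derivative _ _ =
    fun x => f x * partial_derivative g i x + g x * partial_derivative f i x).
    by apply: gen_add; apply: gen_mul.
  by apply/funext => x; rewrite /partial_derivative [LHS]deriveM.
Qed.

Lemma smooth_generated f : generated smooth f -> smooth f.
Proof.
apply: generated_smooth => g sg; split; first exact: smooth_C1.
by move=> i; apply: gen_mem; exact: smooth_partial.
Qed.

Lemma smooth_cst c : smooth (fun _ : 'rV[R]_N => c : R).
Proof. by apply: smooth_generated; exact: gen_cst. Qed.

Lemma smoothD f g : smooth f -> smooth g -> smooth (fun x => f x + g x).
Proof. by move=> sf sg; apply: smooth_generated; apply: gen_add; exact: gen_mem. Qed.

Lemma smoothM f g : smooth f -> smooth g -> smooth (fun x => f x * g x).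
Proof. by move=> sf sg; apply: smooth_generated; apply: gen_mul; exact: gen_mem. Qed.

(** The derivatives of [h] are polynomial in [h], so the algebra generated by [h] and the smooth
    functions is stable. Reciprocals and inverse square roots are of this kind. *)
Lemma smooth_algebraic f h (c : R) k : smooth f -> C1 h ->
  (forall i x, partial_derivative h i x = c * h x ^+ k * partial_derivative f i x) ->
  smooth h.
Proof.
move=> sf ch dh; pose G : set ('rV[R]_N -> R) := fun g => smooth g \/ g = h.
apply: (@generated_smooth G); last by apply: gen_mem; right.
have powG n : generated G (fun x => h x ^+ n).
  elim: n => [|n IH]; first by under eq_fun do rewrite expr0; exact: gen_cst.
  by under eq_fun do rewrite exprS; apply: gen_mul => //; apply: gen_mem; right.
move=> g [sg|->].
  split; first exact: smooth_C1.
  by move=> i; apply: gen_mem; left; exact: smooth_partial.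
split; first exact: ch.
  move=> i; rewrite (_ : partial_derivative h i =
    fun x => c * h x ^+ k * partial_derivative f i x); last by apply/funext => x; exact: dh.
  apply: gen_mul; last by apply: gen_mem; left; exact: smooth_partial.
  by apply: gen_mul => //; exact: gen_cst.
Qed.

Lemma smoothV f : smooth f -> (forall x, 0 < f x) -> smooth (fun x => (f x)^-1).
Proof.
move=> sf f0; have [cf df] := smooth_C1 sf.
have fn0 x : f x != 0 by exact: lt0r_neq0.
apply: (smooth_algebraic (c := -1) (k := 2) sf).
  split=> [x|i x]; last exact: derivableV.
  by apply: continuousV => //; exact: cf.
by move=> i x; rewrite /partial_derivative deriveV//= mulN1r exprVn.
Qed.

Lemma smooth_sqrt f : smooth f -> (forall x, 0 < f x) -> smooth (fun x => Num.sqrt (f x)).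
Proof.
move=> sf f0; have [cf df] := smooth_C1 sf.
have s0 x : 0 < Num.sqrt (f x) by rewrite sqrtr_gt0.
have sn0 x : Num.sqrt (f x) != 0 by exact: lt0r_neq0.
have dS i x : is_derive x (e i) (Num.sqrt \o f)
    ((2 * Num.sqrt (f x))^-1 * 'D_(e i) f x).
  by apply: is_derive_chain; [exact: is_derive1_sqrt|exact: derivableP].
(* The derivative of sqrt f is not polynomial in sqrt f, but its reciprocal [h] satisfies dh =
   -(1/2) h^3 df, and sqrt f = f h. *)
pose h x := (Num.sqrt (f x))^-1.
have sh : smooth h.
  apply: (smooth_algebraic (c := - 2^-1) (k := 3) sf).
    split=> [x|i x].
      have cs : continuous_at x (Num.sqrt \o f).
        by apply: continuous_comp; [exact: cf|exact: sqrt_continuous].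
      by have := cvgV _ cs; apply; exact: sn0.
    have [dx _] := dS i x; exact: (derivableV (f := Num.sqrt \o f) (sn0 x) dx).
  move=> i x; have [dx ddx] := dS i x.
  rewrite /partial_derivative (deriveV (f := Num.sqrt \o f) (sn0 x) dx) ddx.
  rewrite -[LHS]/(_ * _) /= -exprVn invfM /h; ring.
rewrite (_ : (fun x => _) = fun x => f x * h x); first exact: smoothM.
apply/funext => x; rewrite /h -{2}[f x]sqr_sqrtr; last exact: ltW.
by rewrite expr2 mulfK.
Qed.

End smooth_algebra.

(** * Borel sets of R^N and test functions *)

Section borel_rV.
Context {R : realType} {N : nat}.
Implicit Types (x y : 'rV[R]_N) (r : R).
Local Notation leb := (@lebesgue_rV R N).

Lemma coord_le_norm x i : `|x ord0 i| <= `|x|.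
Proof.
have /mapP[j Hj ->] : `|x ord0 i| \in [seq `|x z.1 z.2| | z : 'I_1 * 'I_N].
  by apply/mapP; exists (ord0, i) => //=; rewrite mem_enum.
by rewrite [leRHS]/Num.norm /= mx_normrE; apply/bigmax_geP; right => /=; exists j.
Qed.

Definition cube x r : set 'rV[R]_N := [set y | forall i, `|y ord0 i - x ord0 i| <= r].

Lemma cubeE x r :
  cube x r = [set y | forall i, `[x ord0 i - r, x ord0 i + r]%classic (y ord0 i)].
Proof.
apply/seteqP; split => y h i; have := h i; rewrite /= in_itv /= ler_distl.
  by move=> ->.
by [].
Qed.

Lemma measurable_cube x r : measurable (cube x r).
Proof.
rewrite (_ : cube x r = \bigcap_(i : 'I_N)
    ((fun y : 'rV[R]_N => y ord0 i : measurableTypeR R) @^-1`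
       `[x ord0 i - r, x ord0 i + r]%classic)).
  apply: fin_bigcap_measurable => // i _.
  by rewrite -[X in measurable X]setTI; apply: measurable_coord => //; exact: measurable_itv.
by rewrite cubeE; apply/seteqP; split => y h i; [move=> _|]; exact: h.
Qed.

Lemma lebesgue_cube x r : 0 <= r -> leb (cube x r) = ((2 * r) ^+ N)%:E.
Proof.
move=> r0; rewrite cubeE.
rewrite (@lebesgue_rV_box R N (fun i => `[x ord0 i - r, x ord0 i + r]%classic)); last first.
  by move=> i; exact: measurable_itv.
have E i : lebesgue_measure `[x ord0 i - r, x ord0 i + r]%classic = (2 * r)%:E.
  rewrite lebesgue_measure_itv /= lte_fin; case: ifPn => h.
    by rewrite -EFinD; congr EFin; ring.
  by congr EFin; rewrite -leNgt in h; lra.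
by under eq_bigr do rewrite E; rewrite prodEFin prodr_const card_ord.
Qed.

(** The sigma-algebra comes from the coordinates, so an open set is written as the union of the
    countably many closed cubes of rational centre and radius 1/(k+1) that it contains. *)
Lemma open_measurable_rV (U : set 'rV[R]_N) : open U -> measurable U.
Proof.
move=> oU.
pose c (p : 'rV[rat]_N * nat) : 'rV[R]_N := map_mx ratr p.1.
pose F (p : 'rV[rat]_N * nat) := if `[< cube (c p) p.2.+1%:R^-1 `<=` U >]
  then cube (c p) p.2.+1%:R^-1 else set0.
rewrite (_ : U = \bigcup_p F p).
  apply: countable_bigcupT_measurable => [|p]; first exact: countableP.
  rewrite /F.
  by case: ifPn => // _; exact: measurable_cube.
apply/seteqP; split => [x Ux|x [p _]]; last first.
  by rewrite /F; case: ifPn => // /asboolP; exact.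
have /nbhs_ballP[e /= e0 He] : nbhs x U by exact: open_nbhs_nbhs.
(* A cube of radius below e/2 around a rational point that close to x contains x and stays within
   distance e of it. *)
have [k _ Hk] := near_infty_natSinv_lt (PosNum (divr_gt0 e0 (ltr0n R 2))).
have {Hk} hk : (k.+1%:R^-1 : R) < e / 2 by apply: Hk => /=.
have k0 : 0 < (k.+1%:R^-1 : R) by rewrite invr_gt0.
set w : R := k.+1%:R^-1 in hk k0.
have /choice[f hf] (i : 'I_N) : exists q : rat, `|x ord0 i - ratr q| < w.
  have : x ord0 i - w < x ord0 i + w by lra.
  move=> /rat_in_itvoo[q]; rewrite in_itv /= => hq; exists q.
  by rewrite distrC ltr_distl.
pose p : 'rV[rat]_N * nat := (\row_i f i, k).
have cp i : c p ord0 i = ratr (f i) by rewrite /c /= !mxE.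
have wE : p.2.+1%:R^-1 = w by [].
exists p => //; rewrite /F wE asboolT; first by move=> i; rewrite cp ltW.
move=> y hy; apply: He; split => // i j; rewrite (ord1 i).
have := hy j; rewrite cp => h1; have h2 := hf j.
rewrite /ball /= -(subrKA (ratr (f j))) (le_lt_trans (ler_normD _ _))//.
by rewrite [`|ratr _ - _|]distrC; lra.
Qed.

Lemma continuous_measurable_rV (f : 'rV[R]_N -> R) : continuous f ->
  measurable_fun setT (f : 'rV[R]_N -> measurableTypeR R).
Proof.
move=> /continuousP cf; apply: (measurability _ (RGenOpens.measurableE R)).
move=> _ [_ [a [b ->] <-]]; rewrite setTI.
by apply: open_measurable_rV; apply: cf; exact: interval_open.
Qed.

End borel_rV.

Section test_functions.
Context {R : realType} {N : nat} (Omega : set 'rV[R]_N).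
Implicit Types f g : 'rV[R]_N -> R.

Lemma test_function_support f g : test_function Omega f -> smooth g ->
  (forall x, f x = 0 -> g x = 0) -> test_function Omega g.
Proof.
move=> [sf cf fO] sg fg.
have fgs : closure [set x | g x != 0] `<=` closure [set x | f x != 0].
  by apply: closureS => x /= gx; apply: contra_neq gx; exact: fg.
split=> //; last exact: subset_trans fO.
by apply: subclosed_compact cf _ => //; exact: closed_closure.
Qed.

Lemma test_function_continuous f : test_function Omega f -> continuous f.
Proof. by move=> [/smooth_C1[]]. Qed.

Lemma test_function_measurable f : test_function Omega f ->
  measurable_fun setT (f : 'rV[R]_N -> measurableTypeR R).
Proof. by move=> /test_function_continuous; exact: continuous_measurable_rV. Qed.

Lemma test_function_out f x : test_function Omega f -> ~ Omega x -> f x = 0.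
Proof.
move=> [_ _ fO] Ox; apply/eqP; apply: contra_notT Ox => fx.
by apply: fO; exact: subset_closure.
Qed.

Lemma test_function_bounded f : test_function Omega f ->
  exists2 M : R, 0 < M & forall x, `|f x| <= M.
Proof.
move=> tf; have cf := test_function_continuous tf; have [_ kf _] := tf.
have : bounded_set (f @` closure [set x | f x != 0]).
  by apply: compact_bounded; apply: continuous_compact => //; exact: continuous_subspaceT.
move=> [M [_ HM]]; exists (`|M| + 1); first by rewrite ltr_wpDl.
move=> x; have [->|fx] := eqVneq (f x) 0; first by rewrite normr0 addr_ge0.
apply: HM; first by rewrite ltr_pwDr// ler_norm.
by exists x => //; exact: subset_closure.
Qed.

End test_functions.

(** Subtracting [d] makes this regularization of |t| vanish at 0, so that composition with a test
    function does not enlarge the support; being 1-Lipschitz, it does not increase energies. *)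
Definition smooth_abs {R : realType} (d t : R) : R := Num.sqrt (t ^+ 2 + d ^+ 2) - d.

Section smooth_abs.
Context {R : realType} (d : R).
Hypothesis d0 : 0 < d.
Implicit Types s t : R.
Local Notation a := (smooth_abs d).

Lemma smooth_abs0 : a 0 = 0.
Proof. by rewrite /smooth_abs expr0n add0r sqrtr_sqr gtr0_norm// subrr. Qed.

Lemma smooth_abs_ge0 t : 0 <= a t.
Proof.
rewrite /smooth_abs subr_ge0 -[X in X <= _](gtr0_norm d0) -sqrtr_sqr ler_wsqrtr//.
by rewrite lerDr sqr_ge0.
Qed.

Lemma smooth_abs_le t : a t <= `|t|.
Proof.
rewrite /smooth_abs lerBlDr -(ler_pXn2r (n := 2))// ?nnegrE ?sqrtr_ge0 ?addr_ge0 ?(ltW d0)//.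
rewrite sqr_sqrtr ?addr_ge0 ?sqr_ge0//.
rewrite sqrrD real_normK ?num_real//; have := mulr_ge0 (normr_ge0 t) (ltW d0).
by lra.
Qed.

Lemma smooth_abs_ge t : `|t| - d <= a t.
Proof. by rewrite lerD2r -sqrtr_sqr ler_wsqrtr// lerDl sqr_ge0. Qed.

Lemma smooth_abs_lip s t : `|a s - a t| <= `|s - t|.
Proof.
rewrite /smooth_abs opprB addrA subrK.
set x := Num.sqrt (s ^+ 2 + _); set y := Num.sqrt _.
have x0 : 0 < x by rewrite sqrtr_gt0 ltr_pwDr ?exprn_gt0 ?sqr_ge0.
have y0 : 0 < y by rewrite sqrtr_gt0 ltr_pwDr ?exprn_gt0 ?sqr_ge0.
have xE : x ^+ 2 = s ^+ 2 + d ^+ 2 by rewrite sqr_sqrtr// addr_ge0// sqr_ge0.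
have yE : y ^+ 2 = t ^+ 2 + d ^+ 2 by rewrite sqr_sqrtr// addr_ge0// sqr_ge0.
rewrite -(ler_pXn2r (n := 2))// ?nnegrE// !real_normK ?num_real//.
(* Cauchy-Schwarz for (s, d) and (t, d); after squaring, the defect is d^2 (s - t)^2. *)
have h : s * t + d ^+ 2 <= x * y.
  have [neg|pos] := lerP (s * t + d ^+ 2) 0; first by apply: le_trans neg _; rewrite ltW// mulr_gt0.
  have xy0 : 0 < x * y by rewrite mulr_gt0.
  rewrite -(ler_pXn2r (n := 2)) ?nnegrE ?(ltW pos) ?(ltW xy0)// exprMn xE yE.
  have := sqr_ge0 (d * (s - t)); nra.
nra.
Qed.

Lemma smooth_smooth_abs N (f : 'rV[R]_N -> R) : smooth f -> smooth (fun x => a (f x)).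
Proof.
move=> sf; apply: smoothD; last exact: smooth_cst.
apply: smooth_sqrt.
  by apply: smoothD; [under eq_fun do rewrite expr2; exact: smoothM|exact: smooth_cst].
by move=> x; rewrite ltr_pwDr ?exprn_gt0 ?sqr_ge0.
Qed.

End smooth_abs.

Lemma smooth_abs_cvg {R : realType} (d t : nat -> R) (l : R) :
  (forall n, 0 < d n) -> d @ \oo --> (0 : R) -> t @ \oo --> l ->
  (fun n => smooth_abs (d n) (t n)) @ \oo --> `|l|.
Proof.
move=> d0 dl tl; apply: (cvg_sub0 _ (cvg_norm tl)); apply: cvg0_le dl => n.
have := smooth_abs_le (d0 n) (t n); have := smooth_abs_ge (d n) (t n).
by rewrite ler_norml => *; apply/andP; split; lra.
Qed.

(** * A Poincare inequality for functions of small support *)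

(** On the diagonal the conventions for powers and inverses give the value 0 when N + 2s is nonzero,
    so lower bounds have to assume [x != y]. *)
Definition gagliardo_kernel {R : realType} {N : nat} (s : R) (z : 'rV[R]_N * 'rV[R]_N) : R :=
  (euclidean_norm (z.1 - z.2) `^ (N%:R + 2 * s))^-1.

Section kernel.
Context {R : realType} {N : nat} (s : R).
Implicit Types (x y : 'rV[R]_N) (r : R) (w : 'rV[R]_N -> R).
Local Notation leb := (@lebesgue_rV R N).
Local Notation ker := (@gagliardo_kernel R N s).

Lemma gagliardo_kernel_ge0 z : 0 <= ker z.
Proof. by rewrite invr_ge0 powR_ge0. Qed.

Lemma euclidean_norm_gt0 x : x != 0 -> 0 < euclidean_norm x.
Proof.
move=> x0; rewrite sqrtr_gt0 lt_neqAle eq_sym sumr_ge0 ?andbT; last first.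
  by move=> i _; exact: sqr_ge0.
apply: contra x0; rewrite psumr_eq0; last by move=> i _; exact: sqr_ge0.
move=> /allP h; apply/eqP/rowP => i; rewrite mxE.
by have := h i (mem_index_enum _); rewrite sqrf_eq0 => /eqP.
Qed.

Lemma euclidean_norm_le x r : (forall i, `|x ord0 i| <= r) -> 0 <= r ->
  euclidean_norm x <= Num.sqrt N%:R * r.
Proof.
move=> xr r0; rewrite /euclidean_norm -[in leRHS](ger0_norm r0) -sqrtr_sqr -sqrtrM//.
apply: ler_wsqrtr; apply: (@le_trans _ _ (\sum_(i < N) r ^+ 2)).
  apply: ler_sum => i _; rewrite -[_ ^+ 2]real_normK ?num_real//.
  by rewrite ler_pXn2r// nnegrE.
by rewrite sumr_const card_ord mulr_natl.
Qed.

Lemma gagliardo_kernel_lb x y r : 0 < s -> x != y -> 0 <= r ->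
  (forall i, `|x ord0 i - y ord0 i| <= r) ->
  ((Num.sqrt N%:R * r) `^ (N%:R + 2 * s))^-1 <= ker (x, y).
Proof.
move=> s0 xy r0 xyr; rewrite /gagliardo_kernel /=.
have e0 : 0 < euclidean_norm (x - y) by rewrite euclidean_norm_gt0// subr_eq0.
have le : euclidean_norm (x - y) <= Num.sqrt N%:R * r.
  by apply: euclidean_norm_le => // i; rewrite !mxE.
have p0 : 0 <= N%:R + 2 * s :> R by rewrite addr_ge0// mulr_ge0// ltW.
by rewrite lef_pV2 ?posrE ?powR_gt0// ?(lt_le_trans e0 le)// ge0_ler_powR// nnegrE ltW// (lt_le_trans e0 le).
Qed.

Lemma measurable_gagliardo_kernel : measurable_fun setT ker.
Proof.
have m : measurable_fun setT (fun z : 'rV[R]_N * 'rV[R]_N => euclidean_norm (z.1 - z.2)).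
  apply: (@measurableT_comp _ _ _ _ _ _ (@Num.sqrt R)).
    by apply: continuous_measurable_fun; exact: sqrt_continuous.
  apply: measurable_sum => i; apply: measurable_funX.
  under eq_fun do rewrite !mxE.
  apply: measurable_funB.
    exact: (measurableT_comp (measurable_coord i) measurable_fst).
  exact: (measurableT_comp (measurable_coord i) measurable_snd).
rewrite /gagliardo_kernel; under eq_fun do rewrite -powRN.
exact: (measurableT_comp (measurable_powR _) m).
Qed.

End kernel.

Section poincare.
Context {R : realType} {N : nat} (s : R).
Implicit Types (x y : 'rV[R]_N) (r : R) (w : 'rV[R]_N -> R).
Local Notation leb := (@lebesgue_rV R N).
Local Notation ker := (@gagliardo_kernel R N s).

(** Half the volume of a cube of half-side r, times a lower bound for the kernel between its centre
    and its other points. It scales as r^(-2s). *)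
Definition poincare_cst r : R :=
  (2 * r) ^+ N / 2 * ((Num.sqrt N%:R * r) `^ (N%:R + 2 * s))^-1.

(* For x with w x <> 0, at least half of the cube of radius r around x lies
   where w vanishes, and there (w x - w y)^2 = (w x)^2. *)
Lemma poincare w r : 0 < s -> 0 <= r -> measurable_fun setT w ->
  (leb [set x | (w x != 0)%R] <= ((2 * r) ^+ N / 2)%:E)%E ->
  ((poincare_cst r)%:E * \int[leb]_x (w x ^+ 2)%:E <= gagliardo_sq s w)%E.
Proof.
move=> s0 r0 mw wr.
pose A : set 'rV[R]_N := [set x | w x != 0].
have mA : measurable A.
  rewrite (_ : A = w @^-1` (~` [set 0])).
    by rewrite -[X in measurable X]setTI; apply: mw => //; exact: measurableC.
  by apply/seteqP; split=> x /= /eqP.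
pose c : R := ((Num.sqrt N%:R * r) `^ (N%:R + 2 * s))^-1.
have c0 : 0 <= c by rewrite invr_ge0 powR_ge0.
pose S1 : set ('rV[R]_N * 'rV[R]_N) := [set z | cube z.1 r z.2].
pose S2 : set ('rV[R]_N * 'rV[R]_N) := [set z | ~ A z.2].
pose S := S1 `&` S2.
have mS : measurable S.
  apply: measurableI.
    rewrite (_ : S1 = \bigcap_(i : 'I_N)
        ((fun z : 'rV[R]_N * 'rV[R]_N => `|z.2 ord0 i - z.1 ord0 i|) @^-1` `]-oo, r]%classic)).
      apply: fin_bigcap_measurable => // i _.
      rewrite -[X in measurable X]setTI.
      suff m : measurable_fun setT
          (fun z : 'rV[R]_N * 'rV[R]_N => `|z.2 ord0 i - z.1 ord0 i|).
        by apply: m => //; exact: measurable_itv.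
      apply: measurableT_comp => //; apply: measurable_funB.
        exact: (measurableT_comp (measurable_coord i) measurable_snd).
      exact: (measurableT_comp (measurable_coord i) measurable_fst).
    by apply/seteqP; split => z h i; [move=> _ /=; rewrite in_itv /=|
      have /= := h i I; rewrite in_itv /=]; [exact: h|].
  rewrite (_ : S2 = setT `&` (@snd 'rV[R]_N 'rV[R]_N) @^-1` (~` A)); last by rewrite setTI.
  by apply: measurable_snd => //; exact: measurableC.
pose G (z : 'rV[R]_N * 'rV[R]_N) : R := w z.1 ^+ 2 * c * \1_S z.
have G0 z : 0 <= G z by rewrite mulr_ge0// mulr_ge0// sqr_ge0.
have mw1 : measurable_fun setT (fun z : 'rV[R]_N * 'rV[R]_N => w z.1).
  exact: (measurableT_comp mw measurable_fst).
have mw2 : measurable_fun setT (fun z : 'rV[R]_N * 'rV[R]_N => w z.2).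
  exact: (measurableT_comp mw measurable_snd).
have mG : measurable_fun setT G.
  apply: measurable_funM; last exact: measurable_indic.
  by apply: measurable_funM => //; exact: measurable_funX.
apply: (@le_trans _ _ (\int[leb \x leb]_z (G z)%:E)%E); last first.
  apply: ge0_le_integral => //.
  - by move=> z _; rewrite lee_fin.
  - exact/measurable_EFinP.
  - apply/measurable_EFinP; apply: measurable_funM; last exact: measurable_gagliardo_kernel.
    by apply: measurable_funX; exact: measurable_funB.
  move=> -[x y] _; rewrite lee_fin /G indicE /=.
  have [/set_mem [xy nAy]|_] := boolP ((x, y) \in S); last first.
    by rewrite mulr0 mulr_ge0// ?sqr_ge0// invr_ge0 powR_ge0.
  have wy : w y = 0 by apply/eqP/negPn/negP.
  rewrite mulr1 wy subr0.
  have [->|wx] := eqVneq (w x) 0; first by rewrite expr0n !mul0r.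
  apply: ler_wpM2l; first exact: sqr_ge0.
  apply: gagliardo_kernel_lb => // [|i]; last by rewrite distrC; exact: xy.
  by apply: contra_neq wx => ->.
rewrite fubini_tonelli1//; last exact/measurable_EFinP.
rewrite -ge0_integralZl//; last 3 first.
- by apply/measurable_EFinP; exact: measurable_funX.
- by move=> x _; rewrite lee_fin sqr_ge0.
- by rewrite lee_fin mulr_ge0// mulr_ge0// exprn_ge0// mulr_ge0.
apply: ge0_le_integral => //.
- by move=> x _; rewrite -EFinM lee_fin mulr_ge0 ?sqr_ge0// mulr_ge0// mulr_ge0// exprn_ge0// mulr_ge0.
- by apply: measurable_funeM; apply/measurable_EFinP; exact: measurable_funX.
- by apply: measurable_fun_fubini_tonelli_F => //; exact/measurable_EFinP.
move=> x _; rewrite /fubini_F /G /=.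
have -> : (\int[leb]_y (w x ^+ 2 * c * \1_S (x, y))%:E =
    (w x ^+ 2 * c)%:E * leb (cube x r `\` A))%E.
  under eq_integral do rewrite EFinM.
  have mC : measurable (cube x r `\` A) by apply: measurableD => //; exact: measurable_cube.
  have iE y : \1_S (x, y) = \1_(cube x r `\` A) y :> R.
    by rewrite !indicE; congr ((_ : bool)%:R); apply/idP/idP; move=> /set_mem ?; apply/mem_set.
  under eq_integral do rewrite iE.
  rewrite ge0_integralZl//.
  - by rewrite -[in RHS](setIT (cube x r `\` A)) -integral_indic.
  - by apply/measurable_EFinP; exact: measurable_indic.
  - by rewrite lee_fin mulr_ge0// sqr_ge0.
have h : (((2 * r) ^+ N / 2)%:E <= leb (cube x r `\` A))%E.
  have mQ := measurable_cube x r.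
  have : (((2 * r) ^+ N)%:E <= leb (cube x r `\` A) + ((2 * r) ^+ N / 2)%:E)%E.
    rewrite -(lebesgue_cube x r0) (measureDI leb mQ mA) leeD2l//.
    by apply: le_trans wr; apply: le_measure; rewrite ?inE//; exact: measurableI.
  by rewrite -leeBlDr// -EFinB; apply: le_trans; rewrite lee_fin; lra.
rewrite (_ : poincare_cst r = (2 * r) ^+ N / 2 * c)// -EFinM.
rewrite (_ : _ * w x ^+ 2 = (w x ^+ 2 * c) * ((2 * r) ^+ N / 2)); last by ring.
rewrite EFinM; apply: lee_wpmul2l => //.
by rewrite lee_fin mulr_ge0// sqr_ge0.
Qed.
End poincare.

Section bounded_domains.
Context {R : realType} {N : nat} (s : R).
Hypothesis (N0 : (0 < N)%N) (s0 : 0 < s).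
Local Notation leb := (@lebesgue_rV R N).
Local Notation ker := (@gagliardo_kernel R N s).

Let sqrtN0 : 0 < Num.sqrt N%:R :> R.
Proof. by rewrite sqrtr_gt0 ltr0n. Qed.

Lemma poincare_cst_gt0 r : 0 < r -> 0 < @poincare_cst R N s r.
Proof.
by move=> r0; rewrite mulr_gt0// ?divr_gt0// ?exprn_gt0 ?invr_gt0 ?powR_gt0 ?mulr_gt0.
Qed.

(** With C the value at r = 1, the constant is C r^(-2s); the witness solves C r^(-2s) = M'. Taking
    the maximum with 1 only keeps M' positive. *)
Lemma poincare_cst_large (M : R) : exists2 r, 0 < r & M <= @poincare_cst R N s r.
Proof.
pose M' := Num.max M 1.
have M'0 : 0 < M' by rewrite lt_max ltr01 orbT.
pose C : R := 2 ^+ N / 2 * (Num.sqrt N%:R `^ (N%:R + 2 * s))^-1.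
have C0 : 0 < C by rewrite mulr_gt0 ?divr_gt0 ?exprn_gt0 ?invr_gt0 ?powR_gt0.
have s2 : 2 * s != 0 by rewrite mulf_neq0// lt0r_neq0.
exists ((C / M') `^ (2 * s)^-1); first by rewrite powR_gt0// divr_gt0.
set r := _ `^ _.
have r0 : 0 < r by rewrite powR_gt0// divr_gt0.
have rs : r `^ (2 * s) = C / M'.
  by rewrite -powRrM mulVf// powRr1// ltW// divr_gt0.
have rN : r `^ (N%:R + 2 * s) = r ^+ N * (C / M').
  by rewrite powRD ?(lt0r_neq0 r0) ?implybT// rs powR_mulrn ?ltW.
apply: (@le_trans _ _ M'); first by rewrite le_max lexx.
rewrite /poincare_cst powRM ?(ltW r0) ?(ltW sqrtN0)// rN exprMn.
rewrite (_ : _ * _ = C * (r ^+ N * (r ^+ N * (C / M'))^-1)); last first.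
  by rewrite /C !invfM; ring.
have rN0 : r ^+ N != 0 by rewrite lt0r_neq0// exprn_gt0.
have [Cn0 M'n0] : C != 0 /\ M' != 0 by rewrite !lt0r_neq0.
by rewrite le_eqVlt; apply/orP; left; apply/eqP; field; rewrite rN0 Cn0 M'n0.
Qed.

Variables (Omega : set 'rV[R]_N).
Hypothesis Omega_bounded : bounded_set Omega.

Lemma bounded_sub_cube : exists2 M : R, 0 < M & Omega `<=` cube 0 M.
Proof.
move: Omega_bounded => [M [_ HM]]; exists (`|M| + 1); first by rewrite ltr_wpDl.
move=> x Ox i; rewrite mxE subr0; apply: le_trans (coord_le_norm x i) _.
by apply: HM => //; rewrite ltr_pwDr// ler_norm.
Qed.

(** With this [r], [poincare] applies to every measurable function vanishing outside Omega: the
    ordinary Poincare inequality of a bounded domain. *)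
Lemma bounded_measure_poincare : exists2 r, 0 < r &
  forall A : set 'rV[R]_N, measurable A -> A `<=` Omega -> (leb A <= ((2 * r) ^+ N / 2)%:E)%E.
Proof.
(* Doubling the half-side multiplies the volume by 2^N, at least 2 since N >= 1, which compensates
   the division by 2. *)
have [M M0 OM] := bounded_sub_cube; exists (2 * M) => [|A mA AO]; first by rewrite mulr_gt0.
apply: (@le_trans _ _ (leb (cube 0 M))).
  by apply: le_measure; rewrite ?inE//; [exact: measurable_cube|exact: subset_trans OM].
have M0' := ltW M0; have M20 : 0 <= 2 * M by rewrite mulr_ge0.
rewrite lebesgue_cube// lee_fin [in leRHS]exprMn mulrAC.
rewrite ler_peMl ?exprn_ge0//.
by rewrite ler_pdivlMr// mul1r -[X in X <= _]expr1 ler_weXn2l// ler1n.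
Qed.

Lemma kernel_lb_bounded : exists2 k : R, 0 < k &
  forall x y, Omega x -> Omega y -> x != y -> k <= ker (x, y).
Proof.
have [M M0 OM] := bounded_sub_cube.
exists (((Num.sqrt N%:R * (2 * M)) `^ (N%:R + 2 * s))^-1).
  by rewrite invr_gt0 powR_gt0// !mulr_gt0.
move=> x y Ox Oy xy; apply: gagliardo_kernel_lb => //; first by rewrite mulr_ge0// ltW.
move=> i; have := OM _ Ox i; have := OM _ Oy i; rewrite !mxE !subr0 !ler_norml.
by move=> /andP[? ?] /andP[? ?]; apply/andP; split; lra.
Qed.

End bounded_domains.

(** * Energies and approximation by test functions *)

Section powR_facts.
Context {R : realType}.
Implicit Types a b p t : R.

Lemma powR_le_l a b p : 0 <= p -> 0 <= a -> a <= b -> a `^ p <= b `^ p.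
Proof.
move=> p0 a0 ab; apply: ge0_ler_powR => //; rewrite nnegrE //.
exact: le_trans ab.
Qed.

Lemma powRD_le a b p : 0 <= p -> 0 <= a -> 0 <= b ->
  (a + b) `^ p <= 2 `^ p * (a `^ p + b `^ p).
Proof.
move=> p0 a0 b0.
have [ab|ba] := leP a b.
  apply: (@le_trans _ _ ((2 * b) `^ p)); first by apply: powR_le_l; rewrite ?addr_ge0//; lra.
  by rewrite powRM// ler_wpM2l ?powR_ge0// lerDr powR_ge0.
apply: (@le_trans _ _ ((2 * a) `^ p)); first by apply: powR_le_l; rewrite ?addr_ge0//; lra.
by rewrite powRM// ler_wpM2l ?powR_ge0// lerDl powR_ge0.
Qed.

Lemma powR_sub1M a p : 0 <= a -> p != 0 -> a `^ (p - 1) * a = a `^ p.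
Proof.
move=> a0 p0; have [->|an0] := eqVneq a 0; first by rewrite mulr0 powR0.
rewrite -{2}(powRr1 a0) -powRD; first by rewrite subrK.
by rewrite an0 implybT.
Qed.

(** A crude Young inequality: both factors are bounded through the larger of a and b. *)
Lemma powR_mixed_le a b p : 1 < p -> 0 <= a -> 0 <= b ->
  a `^ (p - 1) * b <= a `^ p + b `^ p.
Proof.
move=> p1 a0 b0; have pn0 : p != 0 by rewrite lt0r_neq0//; lra.
have p10 : 0 <= p - 1 by lra.
have [ab|ba] := leP a b.
  apply: (@le_trans _ _ (b `^ p)); last by rewrite lerDr powR_ge0.
  by rewrite -(powR_sub1M b0 pn0) ler_wpM2r// powR_le_l.
apply: (@le_trans _ _ (a `^ p)); last by rewrite lerDl powR_ge0.
by rewrite -[leRHS](powR_sub1M a0 pn0) ler_wpM2l ?powR_ge0// ltW.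
Qed.

Lemma norm_powR_signed t p : 1 < p -> p != 2 -> `| `|t| `^ (p - 2) * t| = `|t| `^ (p - 1).
Proof.
move=> p1 p2; rewrite normrM ger0_norm ?powR_ge0//.
rewrite (_ : p - 2 = (p - 1) - 1); last by ring.
by rewrite powR_sub1M// lt0r_neq0//; lra.
Qed.

Lemma powR_cvg (p : R) (t : nat -> R) (l : R) : 0 < p -> (forall n, 0 <= t n) ->
  t @ \oo --> l -> (fun n => t n `^ p) @ \oo --> l `^ p.
Proof.
move=> p0 t0 tl.
have l0 : 0 <= l by apply: ler_cvg_to (cvg_cst (0 : R)) tl _; exact: nearW.
have [l00|lp] : l = 0 \/ 0 < l.
- by move: l0; rewrite le_eqVlt => /orP[/eqP <-|]; [left|right].
(* For p < 1 the power is not differentiable at 0, so this case is settled with the threshold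
   e^(1/p). *)
- rewrite l00 powR0 ?lt0r_neq0//; rewrite l00 in tl.
  apply/cvgrPdist_lt => e e0.
  have e'0 : 0 < e `^ p^-1 by rewrite powR_gt0.
  have [M HM] := cvg0_small tl e'0.
  exists M => // n /= /HM; rewrite sub0r normrN !ger0_norm ?powR_ge0// => tn.
  have -> : e = (e `^ p^-1) `^ p by rewrite -powRrM mulVf ?lt0r_neq0// powRr1// ltW.
  by apply: gt0_ltr_powR; rewrite ?nnegrE ?powR_ge0.
- have c : {for l, continuous (fun x : R => x `^ p)}.
    apply: differentiable_continuous; apply/derivable1_diffP.
    by have [] := is_derive1_powR p lp.
  exact: (cvg_comp _ _ tl c).
Qed.

Lemma powR_cvg0_inv (p : R) (t : nat -> R) : 0 < p -> (forall n, 0 <= t n) ->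
  (fun n => t n `^ p) @ \oo --> (0 : R) -> t @ \oo --> (0 : R).
Proof.
move=> p0 t0 tl.
have ip : 0 < p^-1 by rewrite invr_gt0.
have := powR_cvg ip (fun n => powR_ge0 (t n) p) tl.
rewrite powR0 ?lt0r_neq0// (_ : (fun n => _) = t)//.
by apply/funext => n; rewrite -powRrM mulfV ?lt0r_neq0// powRr1.
Qed.

End powR_facts.

Section energy.
Context {R : realType} {N : nat} (s : R).
Local Notation V := 'rV[R]_N.
Local Notation leb := (@lebesgue_rV R N).
Local Notation leb2 := (leb \x leb)%E.
Implicit Types u v : V -> R.

Definition gagliardo_integrand u v (z : V * V) : R :=
  (u z.1 - u z.2) * (v z.1 - v z.2) * gagliardo_kernel s z.

Definition finite_energy u := Rintegrable leb2 (gagliardo_integrand u u).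

Definition energy u v : R := \int[leb2]_z gagliardo_integrand u v z.

Lemma gag_ge0 u z : 0 <= gagliardo_integrand u u z.
Proof. by rewrite /gagliardo_integrand -expr2 mulr_ge0 ?sqr_ge0 ?gagliardo_kernel_ge0. Qed.

Lemma measurable_comp_fst u : measurable_fun setT u ->
  measurable_fun setT (fun z : V * V => u z.1).
Proof. by move=> mu; exact: (measurableT_comp mu measurable_fst). Qed.

Lemma measurable_comp_snd u : measurable_fun setT u ->
  measurable_fun setT (fun z : V * V => u z.2).
Proof. by move=> mu; exact: (measurableT_comp mu measurable_snd). Qed.

Lemma measurable_gag u v : measurable_fun setT u -> measurable_fun setT v ->
  measurable_fun setT (gagliardo_integrand u v).
Proof.
move=> mu mv; apply: measurable_funM; last exact: measurable_gagliardo_kernel.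
apply: measurable_funM; apply: measurable_funB;
  by [exact: measurable_comp_fst|exact: measurable_comp_snd].
Qed.

Lemma gag_le u v z :
  `|gagliardo_integrand u v z| <= gagliardo_integrand u u z + gagliardo_integrand v v z.
Proof.
rewrite /gagliardo_integrand -mulrDl normrM (ger0_norm (gagliardo_kernel_ge0 s z)).
apply: ler_wpM2r; first exact: gagliardo_kernel_ge0.
set a := u z.1 - _; set b := v z.1 - _.
by rewrite ler_norml; apply/andP; split; nra.
Qed.

Lemma gag_sq_le u v C z : 0 <= C -> `|u z.1 - u z.2| <= C * `|v z.1 - v z.2| ->
  gagliardo_integrand u u z <= C ^+ 2 * gagliardo_integrand v v z.
Proof.
move=> C0 h; rewrite /gagliardo_integrand mulrA; apply: ler_wpM2r; first exact: gagliardo_kernel_ge0.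
rewrite -!expr2 -exprMn -[leLHS]real_normK ?num_real// -[leRHS]real_normK ?num_real//.
by rewrite ler_pXn2r ?nnegrE// normrM (ger0_norm C0).
Qed.

Lemma gagliardo_sqE u : finite_energy u -> gagliardo_sq s u = (energy u u)%:E.
Proof. by move=> fu; rewrite -Rintegral_fineK. Qed.

Lemma finite_energyP u : measurable_fun setT u -> (gagliardo_sq s u < +oo)%E ->
  finite_energy u.
Proof.
move=> mu h; apply: Rintegrable_ltP h; first exact: measurable_gag.
by move=> z; exact: gag_ge0.
Qed.

Lemma finite_energy_form u v : measurable_fun setT u -> measurable_fun setT v ->
  finite_energy u -> finite_energy v -> Rintegrable leb2 (gagliardo_integrand u v).
Proof.
move=> mu mv fu fv; apply: (Rintegrable_le _ (RintegrableD fu fv)).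
  exact: measurable_gag.
by move=> z; exact: gag_le.
Qed.

Lemma energy_ge0 u : 0 <= energy u u.
Proof. by apply: Rintegral_ge0 => z _; exact: gag_ge0. Qed.

Lemma ae_fst (P : set V) : {ae leb, forall x, P x} -> {ae leb2, forall z, P z.1}.
Proof.
move=> [A [mA A0 PA]]; exists (A `*` setT); split; first exact: measurableX.
  transitivity (leb A * leb setT)%E; first exact: product_measure1E.
  by rewrite A0 mul0e.
by move=> z /= Pz; split => //; exact: PA.
Qed.

Lemma ae_snd (P : set V) : {ae leb, forall x, P x} -> {ae leb2, forall z, P z.2}.
Proof.
move=> [A [mA A0 PA]]; exists (setT `*` A); split; first exact: measurableX.
  transitivity (leb setT * leb A)%E; first exact: product_measure1E.
  by rewrite A0 mule0.
by move=> z /= Pz; split => //; exact: PA.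
Qed.

Lemma ae_gag_cvg (u_ v_ : nat -> V -> R) u v :
  {ae leb, forall x, u_ ^~ x @ \oo --> u x} -> {ae leb, forall x, v_ ^~ x @ \oo --> v x} ->
  {ae leb2, forall z, (fun n => gagliardo_integrand (u_ n) (v_ n) z) @ \oo -->
    gagliardo_integrand u v z}.
Proof.
move=> uu vv.
apply: filterS (filterI (filterI (ae_fst uu) (ae_snd uu)) (filterI (ae_fst vv) (ae_snd vv))).
move=> z [[u1 u2] [v1 v2]].
by apply: cvgM; [apply: cvgM; apply: cvgB|exact: cvg_cst].
Qed.

End energy.

Lemma cvg_subseq {R : realType} (a : nat -> R) (l : R) (sigma : nat -> nat) :
  (forall n, (n <= sigma n)%N) -> a @ \oo --> l -> (a \o sigma) @ \oo --> l.
Proof.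
move=> hs; apply: cvg_comp => A [M _ HM]; exists M => // n /= Mn.
by apply: HM => /=; exact: leq_trans (hs n).
Qed.

(** * Elements of the completion as limits of test functions *)

Section approximation.
Context {R : realType} {N : nat} (s q : R) (Omega : set 'rV[R]_N).
Local Notation V := 'rV[R]_N.
Local Notation leb := (@lebesgue_rV R N).
Local Notation leb2 := (leb \x leb)%E.
Local Notation gag := (gagliardo_integrand s).
Local Notation fe := (finite_energy s).
Local Notation en := (energy s).
Implicit Types u v : V -> R.
Hypothesis q1 : 1 < q.

Let q0 : 0 < q. Proof. by move: q1; lra. Qed.
Let qn0 : q != 0. Proof. exact: lt0r_neq0. Qed.

Definition abs_pow u (x : V) : R := `|u x| `^ q.

Local Notation Lq := abs_pow.

Lemma Lq_ge0 u x : 0 <= Lq u x. Proof. exact: powR_ge0. Qed.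

Lemma measurable_Lq u : measurable_fun setT u -> measurable_fun setT (Lq u).
Proof.
by move=> mu; apply: (measurableT_comp (measurable_powR q)); exact: measurableT_comp.
Qed.

(** Almost everywhere convergence with convergence of the two integrals, in place of convergence in
    norm: this is what lets the powers and energy densities of [phi n] serve as varying majorants
    for nonlinear functions of [phi n]. *)
Record approximated u (phi : nat -> V -> R) : Prop := Approximated {
  approx_meas : measurable_fun setT u;
  approx_out : forall x, ~ Omega x -> u x = 0;
  approx_test : forall n, test_function Omega (phi n);
  approx_ae : {ae leb, forall x, phi ^~ x @ \oo --> u x};
  approx_Lq : Rintegrable leb (Lq u);
  approx_Lqn : forall n, Rintegrable leb (Lq (phi n));
  approx_Lq_cvg : (fun n => \int[leb]_x Lq (phi n) x) @ \oo --> \int[leb]_x Lq u x;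
  approx_en : fe u;
  approx_enn : forall n, fe (phi n);
  approx_en_cvg : (fun n => en (phi n) (phi n)) @ \oo --> en u u }.

(** The majorants converge together with their integrals by [approx_en_cvg]. The fixed [zeta] makes
    room for a second ingredient, such as the competitor in Picone's inequality. *)
Lemma approx_energy_limit u phi zeta (a b : V -> R) (a_ b_ : nat -> V -> R) (C : R) :
  approximated u phi -> fe zeta ->
  (forall n, measurable_fun setT (a_ n)) -> (forall n, measurable_fun setT (b_ n)) ->
  measurable_fun setT a -> measurable_fun setT b ->
  {ae leb, forall x, a_ ^~ x @ \oo --> a x} -> {ae leb, forall x, b_ ^~ x @ \oo --> b x} ->
  (forall n z, `|gag (a_ n) (b_ n) z| <=
     C * (gag u u z + gag zeta zeta z + gag (phi n) (phi n) z)) ->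
  Rintegrable leb2 (gag a b) /\
  (fun n => en (a_ n) (b_ n)) @ \oo --> en a b.
Proof.
move=> ap fz ma_ mb_ ma mb aa bb dom.
have fu := approx_en ap; have fn := approx_enn ap.
have fuz : Rintegrable leb2 (fun z => gag u u z + gag zeta zeta z) by exact: RintegrableD.
apply: (Rdominated_var (A_ := fun n z => C * (gag u u z + gag zeta zeta z + gag (phi n) (phi n) z))
  (A := fun z => C * (gag u u z + gag zeta zeta z + gag u u z))) => //.
- by move=> n; exact: measurable_gag.
- exact: measurable_gag.
- exact: ae_gag_cvg.
- by move=> n; exact: (RintegrableZ _ (RintegrableD fuz (fn n))).
- exact: (RintegrableZ _ (RintegrableD fuz fu)).
- apply: filterS (ae_gag_cvg s (approx_ae ap) (approx_ae ap)) => z hz.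
  by apply: cvgMr; apply: cvgD => //; exact: cvg_cst.
- under eq_fun => n do rewrite (Rint_Z _ (RintegrableD fuz (fn n))) (Rint_D fuz (fn n)).
  rewrite (Rint_Z _ (RintegrableD fuz fu)) (Rint_D fuz fu).
  by apply: cvgMr; apply: cvgD; [exact: cvg_cst|exact: approx_en_cvg].
Qed.

Lemma approx_Lq_limit u phi zeta (f : V -> R) (f_ : nat -> V -> R) (C : R) :
  approximated u phi -> Rintegrable leb (Lq zeta) ->
  (forall n, measurable_fun setT (f_ n)) -> measurable_fun setT f ->
  {ae leb, forall x, f_ ^~ x @ \oo --> f x} ->
  (forall n x, `|f_ n x| <= C * (Lq u x + Lq zeta x + Lq (phi n) x)) ->
  Rintegrable leb f /\ (fun n => \int[leb]_x f_ n x) @ \oo --> \int[leb]_x f x.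
Proof.
move=> ap fz mf_ mf ff dom.
have fu := approx_Lq ap; have fn := approx_Lqn ap.
have fuz : Rintegrable leb (fun z => Lq u z + Lq zeta z) by exact: RintegrableD.
apply: (Rdominated_var (A_ := fun n z => C * (Lq u z + Lq zeta z + Lq (phi n) z))
  (A := fun z => C * (Lq u z + Lq zeta z + Lq u z))) => //.
- by move=> n; exact: (RintegrableZ _ (RintegrableD fuz (fn n))).
- exact: (RintegrableZ _ (RintegrableD fuz fu)).
- apply: filterS (approx_ae ap) => z hz.
  apply: cvgMr; apply: cvgD; first exact: cvg_cst.
  by apply: powR_cvg => //; exact: cvg_norm.
- under eq_fun => n do rewrite (Rint_Z _ (RintegrableD fuz (fn n))) (Rint_D fuz (fn n)).
  rewrite (Rint_Z _ (RintegrableD fuz fu)) (Rint_D fuz fu).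
  by apply: cvgMr; apply: cvgD; [exact: cvg_cst|exact: approx_Lq_cvg].
Qed.

Lemma gagZ c u v z : gag (fun x => c * u x) v z = c * gag u v z.
Proof. by rewrite /gagliardo_integrand; ring. Qed.

Lemma gagZZ c u z : gag (fun x => c * u x) (fun x => c * u x) z = c ^+ 2 * gag u u z.
Proof. by rewrite /gagliardo_integrand; ring. Qed.

Lemma LqZ c u x : Lq (fun x => c * u x) x = `|c| `^ q * Lq u x.
Proof. by rewrite /abs_pow normrM powRM. Qed.

Lemma energyZ c u : fe u ->
  fe (fun x => c * u x) /\
  en (fun x => c * u x) (fun x => c * u x) = c ^+ 2 * en u u.
Proof.
move=> fu; have E : gag (fun x => c * u x) (fun x => c * u x) = fun z => c ^+ 2 * gag u u z.
  by apply/funext => z; exact: gagZZ.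
by rewrite /finite_energy /energy E; split; [exact: RintegrableZ|exact: Rint_Z].
Qed.

Lemma LqZ_int c u : Rintegrable leb (Lq u) ->
  Rintegrable leb (Lq (fun x => c * u x)) /\
  \int[leb]_x Lq (fun x => c * u x) x = `|c| `^ q * \int[leb]_x Lq u x.
Proof.
move=> fu; have E : Lq (fun x => c * u x) = fun x => `|c| `^ q * Lq u x.
  by apply/funext => x; exact: LqZ.
by rewrite E; split; [exact: RintegrableZ|exact: Rint_Z].
Qed.

Lemma test_functionZ c u : test_function Omega u -> test_function Omega (fun x => c * u x).
Proof.
move=> tu; apply: (test_function_support tu); last by move=> x ->; rewrite mulr0.
by apply: smoothM; [exact: smooth_cst|case: tu].
Qed.

Lemma approximatedZ c u phi : approximated u phi ->
  approximated (fun x => c * u x) (fun n x => c * phi n x).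
Proof.
move=> [mu ou tu au Lu Lun Luc eu eun euc]; split.
- exact: measurable_funM.
- by move=> x /ou ->; rewrite mulr0.
- by move=> n; exact: test_functionZ.
- by apply: filterS au => x ?; exact: cvgMr.
- exact: (LqZ_int c Lu).1.
- by move=> n; exact: (LqZ_int c (Lun n)).1.
- under eq_fun => n do rewrite (LqZ_int c (Lun n)).2.
  by rewrite (LqZ_int c Lu).2; exact: cvgMr.
- exact: (energyZ c eu).1.
- by move=> n; exact: (energyZ c (eun n)).1.
- under eq_fun => n do rewrite (energyZ c (eun n)).2.
  by rewrite (energyZ c eu).2; exact: cvgMr.
Qed.

Lemma Lq_normE u : (forall x, ~ Omega x -> u x = 0) ->
  Lq_norm Omega q u = ((\int[leb]_x (Lq u x)%:E) `^ q^-1)%E.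
Proof.
move=> ou; rewrite /Lq_norm unlock; congr (_ `^ _)%E.
apply: eq_integral => x _; rewrite patchE.
case: ifPn => [_ //|/negP xO].
have ux : u x = 0 by apply: ou => Ox; apply: xO; exact/mem_set.
by rewrite /abs_pow ux -[point]/(0%E) abse0 poweR0r// normr0 powR0.
Qed.

Lemma integral_out (f : V -> R) : (forall x, ~ Omega x -> f x = 0) ->
  (\int[leb]_(x in Omega) (f x)%:E = \int[leb]_x (f x)%:E)%E.
Proof.
move=> of_; rewrite integral_mkcond; apply: eq_integral => x _; rewrite patchE.
by case: ifPn => [//|/negP xO]; rewrite of_// => Ox; apply: xO; exact/mem_set.
Qed.

(** Convergence to 0 in the extended reals allows finitely many infinite terms; hence the index
    [n1]. *)
Lemma Lq_norm_cvg0 (v_ : nat -> V -> R) :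
  (forall n, measurable_fun setT (v_ n)) -> (forall n x, ~ Omega x -> v_ n x = 0) ->
  Lq_norm Omega q (v_ n) @[n --> \oo] --> 0%E ->
  exists n1, (forall n, (n1 <= n)%N -> Rintegrable leb (Lq (v_ n))) /\
    (fun n => \int[leb]_x Lq (v_ n) x) @ \oo --> (0 : R).
Proof.
move=> mv ov /fine_cvgP[[n1 _ Hn1] c0]; exists n1; split.
  move=> n /Hn1 /=; rewrite (Lq_normE (ov n)) => fn.
  apply: Rintegrable_ltP; first exact: measurable_Lq.
    by move=> x; exact: Lq_ge0.
  apply: (@lty_poweRy _ _ q^-1); first by rewrite invr_eq0.
  by move: fn; rewrite fin_numE lt_neqAle leey andbT => /andP[].
apply: (@powR_cvg0_inv _ q^-1); first by rewrite invr_gt0.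
  by move=> n; apply: Rintegral_ge0 => x _; exact: Lq_ge0.
apply: cvg_trans c0; apply: near_eq_cvg; apply: nearW => n /=.
by rewrite (Lq_normE (ov n)) fine_poweR.
Qed.


Hypothesis Omega_bounded : bounded_set Omega.

Lemma test_function_Lq phi : test_function Omega phi -> Rintegrable leb (Lq phi).
Proof.
move=> tphi; have [M M0 HM] := test_function_bounded tphi.
have [r r0 Or] := bounded_sub_cube Omega_bounded.
have mc := @measurable_cube R N 0 r.
have fc : (leb (cube 0 r) < +oo)%E by rewrite (lebesgue_cube _ (ltW r0)) ltry.
have ic : Rintegrable leb (fun x => M `^ q * \1_(cube 0 r) x).
  apply: RintegrableZ; exact: Rintegrable_indic.
apply: (Rintegrable_le _ ic).
  by apply: measurable_Lq; exact: test_function_measurable tphi.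
move=> x; rewrite ger0_norm ?Lq_ge0// indicE.
have [xc|/negP xc] := boolP (x \in cube 0 r).
  by rewrite mulr1; apply: powR_le_l => //; exact: ltW.
rewrite mulr0 /abs_pow (test_function_out tphi) ?normr0 ?powR0// => Ox.
by apply: xc; apply/mem_set; exact: Or.
Qed.

Lemma LqD_le (a b c : V -> R) x : c x = a x + b x -> Lq c x <= 2 `^ q * (Lq a x + Lq b x).
Proof.
move=> cE; rewrite /abs_pow cE; apply: le_trans (powRD_le (ltW q0) (normr_ge0 _) (normr_ge0 _)).
by apply: powR_le_l => //; [exact: ltW|exact: ler_normD].
Qed.

Lemma gagD_le (a b c : V -> R) z : (forall x, c x = a x + b x) ->
  gag c c z <= 2 * (gag a a z + gag b b z).
Proof.
move=> cE; rewrite /gagliardo_integrand !cE -mulrDl mulrA.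
apply: ler_wpM2r; first exact: gagliardo_kernel_ge0.
set x := a z.1; set y := a z.2; set x' := b z.1; set y' := b z.2.
by have := sqr_ge0 ((x - y) - (x' - y')); nra.
Qed.

(** A subsequence of the L^q-convergent sequence converges almost everywhere, and Fatou's lemma
    turns the Cauchy property into [phi_m - u] -> 0. For an eigenfunction, the finite energy asked
    in the second half comes from the equation. *)
Lemma D0s2_approx u : D0s2 Omega s q u ->
  Rintegrable leb (Lq u) /\ (fe u -> exists phi, approximated u phi).
Proof.
move=> [mu ou [phi [tphi cphi Lphi]]].
have mphi n : measurable_fun setT (phi n) by exact: test_function_measurable (tphi n).
pose v n x := phi n x - u x.
have mv n : measurable_fun setT (v n) by exact: measurable_funB.
have ov n x : ~ Omega x -> v n x = 0.
  by move=> Ox; rewrite /v ou// (test_function_out (tphi n) Ox) subrr.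
have [n1 [iv cv]] := Lq_norm_cvg0 mv ov Lphi.
have iphi n := test_function_Lq (tphi n).
have iu : Rintegrable leb (Lq u).
  have vn1 : Rintegrable leb (Lq (fun x => - 1 * v n1 x)) := (LqZ_int _ (iv _ (leqnn n1))).1.
  apply: (Rintegrable_le _ (RintegrableZ (2 `^ q) (RintegrableD (iphi n1) vn1))).
    exact: measurable_Lq.
  move=> x; rewrite ger0_norm ?Lq_ge0//; apply: LqD_le.
  by rewrite /v; ring.
split=> // fu.
have cv1 : (fun n => \int[leb]_x Lq (v (n + n1)%N) x) @ \oo --> (0 : R).
  by apply: (cvg_subseq (sigma := fun n => (n + n1)%N)) cv => n; exact: leq_addr.
have [sigma hs aev] := ae_subseq (fun n => iv _ (leq_addl n n1)) (fun n x => Lq_ge0 _ x) cv1.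
pose tau n := (sigma n + n1)%N.
have htau n : (n <= tau n)%N by rewrite /tau (leq_trans (hs n))// leq_addr.
have aeu k : {ae leb, forall x, (fun n => phi (tau (n + k)%N) x) @ \oo --> u x}.
  apply: filterS aev => x hx.
  apply: (cvg_subseq (a := fun n => phi (tau n) x) (sigma := fun n => (n + k)%N)).
    by move=> n; exact: leq_addr.
  apply: (cvg_sub0 (b := fun=> u x)); last exact: cvg_cst.
  by apply/norm_cvg0P; apply: (powR_cvg0_inv q0).
(* Fatou's lemma in k for the energies of phi_m - phi_(tau (k + n0)); the shift by [n0] keeps every
   index in the Cauchy range. *)
have env (e : R) : 0 < e -> exists k0, forall m, (k0 <= m)%N ->
    fe (v m) /\ en (v m) (v m) <= e ^+ 2.
  move=> e0; have [n0 Hn0] := cphi e e0; exists n0 => m mn0.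
  pose a k x := phi m x - phi (tau (k + n0)%N) x.
  have ha k : (gagliardo_sq s (a k) < (e ^+ 2)%:E)%E.
    by apply: Hn0 => //; apply: leq_trans (htau _); exact: leq_addl.
  have ma k : measurable_fun setT (a k) by exact: measurable_funB.
  have fa k : fe (a k) by apply: finite_energyP => //; apply: lt_trans (ha k) (ltry _).
  apply: (Rfatou fa).
  - by move=> n z; exact: gag_ge0.
  - exact: measurable_gag.
  - have aea : {ae leb, forall x, a ^~ x @ \oo --> v m x}.
      by apply: filterS (aeu n0) => x hx; apply: cvgB => //; exact: cvg_cst.
    exact: ae_gag_cvg.
  - by move=> z; exact: gag_ge0.
  - apply: nearW => k; have := ha k; rewrite gagliardo_sqE// lte_fin; exact: ltW.
(* Any positive radius would do: beyond [k1] the differences with u have finite energy, hence so do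
   the approximations. *)
have [k1 Hk1] := env 1 ltr01.
pose psi n := phi (tau (n + k1)%N).
have htk n : (n <= tau (n + k1))%N by rewrite (leq_trans _ (htau _))// leq_addr.
have htk1 n : (k1 <= tau (n + k1))%N by rewrite (leq_trans _ (htau _))// leq_addl.
have htn1 n : (n1 <= tau (n + k1))%N by rewrite /tau leq_addl.
have psiE n x : psi n x = v (tau (n + k1)%N) x + u x by rewrite /v subrK.
have ae0 : {ae leb, forall x, (fun n => v (tau (n + k1)%N) x) @ \oo --> (0 : R)}.
  by apply: filterS (aeu k1) => x hx; exact: cvg_subC.
have aec0 : {ae leb, forall x, (fun n => v (tau (n + k1)%N) x) @ \oo --> (cst 0 x : R)} by [].
have aepsi : {ae leb, forall x, psi ^~ x @ \oo --> u x} by exact: aeu.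
have mpsi n : measurable_fun setT (psi n) by exact: mphi.
have fpsi n : fe (psi n).
  have [fv _] := Hk1 _ (htk1 n).
  apply: (Rintegrable_le _ (RintegrableZ 2 (RintegrableD fv fu))).
    exact: measurable_gag.
  by move=> z; rewrite ger0_norm ?gag_ge0//; exact: gagD_le.
have cLq : (fun n => \int[leb]_x Lq (psi n) x) @ \oo --> \int[leb]_x Lq u x.
  apply: (Rdominated_add (C := 2 `^ q) (h_ := fun n => Lq (v (tau (n + k1)%N))) (h := Lq u) _ _ _ _ _ _ _ _).2.
  - by move=> n; exact: measurable_Lq.
  - exact: measurable_Lq.
  - by apply: filterS aepsi => x hx; apply: powR_cvg => //; exact: cvg_norm.
  - by move=> n; exact: iv.
  - exact: iu.
  - apply: filterS ae0 => x hx; rewrite -(powR0 qn0) -[X in X `^ _](@normr0 R R).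
    by apply: powR_cvg => //; exact: cvg_norm.
  - by move=> n x; rewrite ger0_norm ?Lq_ge0//; apply: LqD_le; exact: psiE.
  - exact: (cvg_subseq htk) cv.
have en0 : (fun n => en (v (tau (n + k1)%N)) (v (tau (n + k1)%N))) @ \oo --> (0 : R).
  apply/cvgrPdist_lt => e e0.
  have e'0 : 0 < Num.sqrt (e / 2) by rewrite sqrtr_gt0 divr_gt0.
  have [k0 Hk0] := env _ e'0; exists k0 => // n /= kn.
  have [_] := Hk0 _ (leq_trans kn (htk n)).
  rewrite sqr_sqrtr ?divr_ge0 ?(ltW e0)// sub0r normrN ger0_norm ?energy_ge0//.
  by move=> h; apply: le_lt_trans h _; rewrite ltr_pdivrMr// ltr_pMr// ltr1n.
have cen : (fun n => en (psi n) (psi n)) @ \oo --> en u u.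
  apply: (Rdominated_add (C := 2) (h_ := fun n => gag (v (tau (n + k1)%N)) (v (tau (n + k1)%N)))
    (h := gag u u) _ _ _ _ _ _ _ _).2.
  - by move=> n; exact: measurable_gag.
  - exact: measurable_gag.
  - exact: ae_gag_cvg.
  - by move=> n; have [] := Hk1 _ (htk1 n).
  - exact: fu.
  - apply: filterS (ae_gag_cvg s aec0 aec0) => z; rewrite /gagliardo_integrand /= subrr !mul0r.
    exact.
  - by move=> n z; rewrite ger0_norm ?gag_ge0//; apply: gagD_le; exact: psiE.
  - exact: en0.
exists psi; split => //.
- by move=> n; exact: tphi.
- by move=> n; exact: iphi.
Qed.

End approximation.

(** * Eigenfunctions *)

Section eigenfunctions.
Context {R : realType} {N : nat} (s q : R) (Omega : set 'rV[R]_N).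
Local Notation V := 'rV[R]_N.
Local Notation leb := (@lebesgue_rV R N).
Local Notation leb2 := (leb \x leb)%E.
Local Notation gag := (gagliardo_integrand s).
Local Notation fe := (finite_energy s).
Local Notation en := (energy s).
Local Notation Lq := (abs_pow q).
Implicit Types u v : V -> R.
Hypotheses (q1 : 1 < q) (q2 : q < 2) (Omega_bounded : bounded_set Omega).

Let q0 : 0 < q. Proof. by move: q1; lra. Qed.
Let qn0 : q != 0. Proof. exact: lt0r_neq0. Qed.
Let qn2 : q != 2. Proof. by rewrite lt_eqF. Qed.

Definition weak_rhs u v : R := \int[leb]_x (`|u x| `^ (q - 2) * u x * v x).

(** Normalization removes the factor |u|_q^(2-q). Finite energy is a condition on [psi], to be
    checked only for the test functions actually used, through Lipschitz bounds. *)
Record eigenfunction (lam : R) u (phi : nat -> V -> R) : Prop := Eigenfunction {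
  eig_approx : approximated s q Omega u phi;
  eig_norm : \int[leb]_x Lq u x = 1;
  eig_energy : en u u = lam;
  eig_weak : forall psi, test_function Omega psi -> fe psi ->
    en u psi = lam * weak_rhs u psi }.

Lemma measurable_weak_rhs u v : measurable_fun setT u -> measurable_fun setT v ->
  measurable_fun setT (fun x => `|u x| `^ (q - 2) * u x * v x).
Proof.
move=> mu mv; apply: measurable_funM => //; apply: measurable_funM => //.
by apply: (measurableT_comp (measurable_powR _)); exact: measurableT_comp.
Qed.

Lemma weak_rhs_le u v x : `| `|u x| `^ (q - 2) * u x * v x| <= Lq u x + Lq v x.
Proof. by rewrite normrM norm_powR_signed// powR_mixed_le. Qed.

Lemma Rintegrable_weak_rhs u v : measurable_fun setT u -> measurable_fun setT v ->
  Rintegrable leb (Lq u) -> Rintegrable leb (Lq v) ->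
  Rintegrable leb (fun x => `|u x| `^ (q - 2) * u x * v x).
Proof.
move=> mu mv iu iv; apply: (Rintegrable_le _ (RintegrableD iu iv)).
  exact: measurable_weak_rhs.
by move=> x; exact: weak_rhs_le.
Qed.

Lemma weak_rhs_diag u : (fun x => `|u x| `^ (q - 2) * u x * u x) = Lq u.
Proof.
apply/funext => x; rewrite -mulrA -expr2 -[u x ^+ 2]real_normK ?num_real// expr2 mulrA.
rewrite (_ : q - 2 = (q - 1) - 1); last by ring.
by rewrite powR_sub1M ?powR_sub1M// subr_eq0 gt_eqF.
Qed.

Lemma test_function_D0s2 psi : test_function Omega psi -> D0s2 Omega s q psi.
Proof.
move=> tpsi; split; first exact: test_function_measurable tpsi.
  by move=> x; exact: test_function_out tpsi.
have E : psi \- psi = (fun=> 0 : R) by apply/funext => x /=; rewrite subrr.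
exists (fun=> psi); split => //.
  move=> e e0; exists 0%N => m n _ _; rewrite E.
  rewrite (_ : gagliardo_sq _ _ = 0%E) ?lte_fin ?exprn_gt0//.
  by apply: integral0_eq => z _; rewrite subrr expr0n /= mul0r.
rewrite E Lq_normE// (_ : (\int[leb]_x _)%E = 0%E) ?poweR0r ?invr_eq0//; first exact: cvg_cst.
by apply: integral0_eq => x _; rewrite /abs_pow normr0 powR0.
Qed.

Lemma semilinear_eigenfunction lam : semilinear_eigenvalue Omega s q lam ->
  exists u phi, eigenfunction lam u phi.
Proof.
move=> [lam0 [u [Du une EL]]].
have [iu apu] := D0s2_approx q1 Omega_bounded Du.
have [mu ou _] := Du.
pose I := \int[leb]_x Lq u x.
have I0 : 0 < I.
  rewrite ltNge; apply/negP => I0; apply: une.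
  have := Rint_eq0 iu (fun x => Lq_ge0 q u x) I0.
  by apply: filterS => x /powR_eq0_eq0/normr0_eq0.
pose a := I `^ q^-1.
have a0 : 0 < a by rewrite powR_gt0.
have aq : a `^ q = I by rewrite -powRrM mulVf// powRr1// ltW.
have NE : Lq_norm Omega q u = a%:E by rewrite Lq_normE// Rintegral_fineK// poweR_EFin.
have ELr psi : D0s2 Omega s q psi -> Rintegrable leb (Lq psi) ->
    gagliardo_form s u psi = (lam * a `^ (2 - q) * weak_rhs u psi)%:E.
  move=> Dpsi ipsi; rewrite (EL _ Dpsi) NE poweR_EFin -EFinM.
  rewrite integral_out; last by move=> x Ox; rewrite ou// mulr0 mul0r.
  rewrite (Rintegral_fineK (Rintegrable_weak_rhs mu _ iu ipsi)) -?EFinM//.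
  by case: Dpsi.
have ELu := ELr _ Du iu.
(* The equation tested with u itself equates its energy with a real number. *)
have fu : fe u.
  apply: Rintegrable_ltP; first exact: measurable_gag.
    by move=> z; exact: gag_ge0.
  by rewrite -[X in (X < _)%E]/(gagliardo_form s u u) ELu ltry.
have enu : en u u = lam * a `^ (2 - q) * I.
  apply: EFin_inj; rewrite -(Rintegral_fineK fu) -[LHS]/(gagliardo_form s u u) ELu.
  by rewrite /weak_rhs weak_rhs_diag.
have [phi ap] := apu fu.
have aM p r : a `^ p * a `^ r = a `^ (p + r) by rewrite powRD// (lt0r_neq0 a0) implybT.
have ai : a^-1 = a `^ (-1) by rewrite powR_inv1// ltW.
(* Division by the L^q-norm [a] scales the left side by a^-1 and [weak_rhs] by a^(1-q); the ratio is
   the factor a^(2-q) of the equation. *)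
exists (fun x => a^-1 * u x), (fun n x => a^-1 * phi n x); split.
- exact: approximatedZ.
- rewrite (LqZ_int _ iu).2// ger0_norm ?invr_ge0 ?(ltW a0)//.
  rewrite -/I -aq ai -powRrM aM mulN1r addNr powRr0//.
- rewrite (energyZ _ fu).2 enu -aq ai -powR_mulrn ?powR_ge0// -powRrM.
  rewrite mulrCA -[RHS]mulr1 -!mulrA; congr (_ * _).
  by rewrite !aM; transitivity (a `^ 0); [congr (_ `^ _); ring|exact: powRr0].
- move=> psi tpsi fpsi.
  have mpsi : measurable_fun setT psi := test_function_measurable tpsi.
  have ipsi := test_function_Lq q1 Omega_bounded tpsi.
  have fupsi := finite_energy_form mu mpsi fu fpsi.
  have enpsi : en u psi = lam * a `^ (2 - q) * weak_rhs u psi.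
    apply: EFin_inj; rewrite -(Rintegral_fineK fupsi) -[LHS]/(gagliardo_form s u psi).
    by apply: ELr => //; exact: test_function_D0s2.
  have -> : en (fun x => a^-1 * u x) psi = a^-1 * en u psi.
    by rewrite -Rint_Z//; apply: eq_Rintegral => z _; rewrite gagZ.
  have -> : weak_rhs (fun x => a^-1 * u x) psi = a^-1 `^ (q - 1) * weak_rhs u psi.
    rewrite /weak_rhs -Rint_Z//; last exact: Rintegrable_weak_rhs.
    apply: eq_Rintegral => x _.
    rewrite normrM powRM// ger0_norm ?invr_ge0 ?(ltW a0)//.
    rewrite -(powR_sub1M (a := a^-1) (p := q - 1)) ?invr_ge0 ?(ltW a0)//; last first.
      by rewrite subr_eq0 gt_eqF.
    by rewrite (_ : q - 1 - 1 = q - 2); ring.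
  rewrite enpsi {1}ai mulrCA -!mulrA; congr (_ * _); rewrite !mulrA; congr (_ * _).
  by rewrite ai -powRrM aM; congr (_ `^ _); ring.
Qed.

(** Extends the equation to functions [psi] not known to lie in the completion: the bounds on
    increments control the energy side, those on values the right-hand side. *)
Lemma eig_weak_limit lam u phi (zeta : V -> R) (psi_ : nat -> V -> R) (psi : V -> R) (C : R) :
  eigenfunction lam u phi -> fe zeta -> Rintegrable leb (Lq zeta) -> 0 <= C ->
  (forall n, test_function Omega (psi_ n)) -> measurable_fun setT psi ->
  {ae leb, forall x, psi_ ^~ x @ \oo --> psi x} ->
  (forall n x y, `|psi_ n x - psi_ n y| <= C * (`|zeta x - zeta y| + `|phi n x - phi n y|)) ->
  (forall n x, `|psi_ n x| <= C * (`|zeta x| + `|phi n x|)) ->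
  [/\ Rintegrable leb2 (gag u psi),
      Rintegrable leb (fun x => `|u x| `^ (q - 2) * u x * psi x) &
      en u psi = lam * weak_rhs u psi].
Proof.
move=> [ap _ _ weak] fz iz C0 tpsi mpsi cpsi lpsi bpsi.
have mpsi_ n : measurable_fun setT (psi_ n) by exact: test_function_measurable (tpsi n).
have mu := approx_meas ap.
have gpsi n z : gag (psi_ n) (psi_ n) z <=
    2 * C ^+ 2 * (gag zeta zeta z + gag (phi n) (phi n) z).
  rewrite /gagliardo_integrand -mulrDl mulrA.
  apply: ler_wpM2r; first exact: gagliardo_kernel_ge0.
  have := lpsi n z.1 z.2.
  rewrite -!expr2.
  set p := psi_ n z.1 - _; set x := zeta z.1 - _; set y := phi n z.1 - _ => h.
  rewrite -[p ^+ 2]real_normK ?num_real//.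
  apply: (@le_trans _ _ ((C * (`|x| + `|y|)) ^+ 2)).
    by rewrite ler_pXn2r ?nnegrE// (le_trans _ h).
  rewrite exprMn -[x ^+ 2]real_normK ?num_real// -[y ^+ 2]real_normK ?num_real//.
  rewrite -subr_ge0; have := mulr_ge0 (sqr_ge0 C) (sqr_ge0 (`|x| - `|y|)).
  by congr (0 <= _); ring.
have fpsi n : fe (psi_ n).
  apply: (Rintegrable_le _ (RintegrableZ (2 * C ^+ 2) (RintegrableD fz (approx_enn ap n)))).
    exact: measurable_gag.
  by move=> z; rewrite ger0_norm ?gag_ge0.
have aeu : {ae leb, forall x, (fun _ : nat => u x) @ \oo --> u x}.
  by apply: aeW => x; exact: cvg_cst.
have [iE cE] : Rintegrable leb2 (gag u psi) /\
    (fun n => en u (psi_ n)) @ \oo --> en u psi.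
  apply: (approx_energy_limit (C := 1 + 2 * C ^+ 2) ap fz (a_ := fun=> u)) => //.
  move=> n z; apply: le_trans (gag_le s _ _ _) _.
  have := gpsi n z; have := gag_ge0 s u z; have := gag_ge0 s zeta z.
  have := gag_ge0 s (phi n) z; have := sqr_ge0 C.
  by move=> c0 g1 g2 g3; have := mulr_ge0 c0 g3; lra.
have [iW cW] : Rintegrable leb (fun x => `|u x| `^ (q - 2) * u x * psi x) /\
    (fun n => weak_rhs u (psi_ n)) @ \oo --> weak_rhs u psi.
  apply: (approx_Lq_limit q1 (C := 1 + C `^ q * 2 `^ q)
    (f_ := fun n x => `|u x| `^ (q - 2) * u x * psi_ n x) ap iz).
  - by move=> n; exact: measurable_weak_rhs.
  - exact: measurable_weak_rhs.
  - by apply: filterS cpsi => x hx; apply: cvgMr.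
  - move=> n x; apply: le_trans (weak_rhs_le _ _ _) _.
    have h : Lq (psi_ n) x <= C `^ q * 2 `^ q * (Lq zeta x + Lq (phi n) x).
      apply: (@le_trans _ _ ((C * (`|zeta x| + `|phi n x|)) `^ q)).
        by apply: powR_le_l => //; exact: ltW.
      rewrite powRM ?addr_ge0// -mulrA ler_wpM2l ?powR_ge0//.
      by apply: powRD_le => //; exact: ltW.
    have := Lq_ge0 q u x; have := Lq_ge0 q zeta x; have := Lq_ge0 q (phi n) x.
    have : 0 <= C `^ q * 2 `^ q by rewrite mulr_ge0 ?powR_ge0.
    by move=> c0 g1 g2 g3; have := mulr_ge0 c0 g3; lra.
split=> //.
have cW' : (fun n => en u (psi_ n)) @ \oo --> lam * weak_rhs u psi.
  under eq_fun do rewrite weak//.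
  exact: cvgMr cW.
by rewrite -(cvg_lim _ cE)// -(cvg_lim _ cW').
Qed.

End eigenfunctions.

(** * Interpolation and a lower bound for the L^1-norm of normalized eigenfunctions *)

Section absorption_tools.
Context {R : realType} {N : nat} (s q : R) (Omega : set 'rV[R]_N).
Local Notation V := 'rV[R]_N.
Local Notation leb := (@lebesgue_rV R N).
Local Notation leb2 := (leb \x leb)%E.
Local Notation gag := (gagliardo_integrand s).
Local Notation fe := (finite_energy s).
Local Notation en := (energy s).
Local Notation Lq := (abs_pow q).
Local Notation eigf := (eigenfunction s q Omega).
Implicit Types u v w f g : V -> R.
Hypotheses (N0 : (0 < N)%N) (s0 : 0 < s) (q1 : 1 < q) (q2 : q < 2).
Hypothesis Omega_bounded : bounded_set Omega.

Let qn0 : q != 0. Proof. by rewrite lt0r_neq0// (lt_trans ltr01). Qed.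
Let q10 : 0 <= q - 1. Proof. by rewrite subr_ge0 ltW. Qed.
Let q2' : 0 <= 2 - q. Proof. by rewrite subr_ge0 ltW. Qed.

Lemma Rintegrable_prod f g : Rintegrable leb f -> Rintegrable leb g ->
  (forall x, 0 <= f x) -> (forall x, 0 <= g x) ->
  Rintegrable leb2 (fun z => f z.1 * g z.2) /\
  \int[leb2]_z (f z.1 * g z.2) = (\int[leb]_x f x) * (\int[leb]_x g x).
Proof.
move=> fi gi f0 g0.
have mf := Rintegrable_measurable fi; have mg := Rintegrable_measurable gi.
have mh : measurable_fun setT (fun z : V * V => f z.1 * g z.2).
  by apply: measurable_funM; [exact: measurable_comp_fst|exact: measurable_comp_snd].
have E : (\int[leb2]_z (f z.1 * g z.2)%:E = ((\int[leb]_x f x) * (\int[leb]_x g x))%:E)%E.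
  rewrite fubini_tonelli1//; last 2 first.
  - exact/measurable_EFinP.
  - by move=> z; rewrite lee_fin mulr_ge0.
  rewrite /fubini_F /= EFinM -(Rintegral_fineK fi) -ge0_integralZr//; last 3 first.
  - exact/measurable_EFinP.
  - by move=> x _; rewrite lee_fin.
  - by rewrite lee_fin Rintegral_ge0.
  apply: eq_integral => x _; rewrite -(Rintegral_fineK gi).
  transitivity (\int[leb]_y ((f x)%:E * (g y)%:E))%E; first by apply: eq_integral => y _.
  by rewrite ge0_integralZl//; [exact/measurable_EFinP|move=> y _; rewrite lee_fin|rewrite lee_fin].
split; last by rewrite /Rintegral E.
apply: Rintegrable_ltP => //; first by move=> z; exact: mulr_ge0.
by rewrite E ltry.
Qed.

Lemma poincare_real w r : 0 < r -> measurable_fun setT w -> fe w ->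
  (leb [set x | (w x != 0)%R] <= ((2 * r) ^+ N / 2)%:E)%E ->
  Rintegrable leb (fun x => w x ^+ 2) /\
  @poincare_cst R N s r * \int[leb]_x (w x ^+ 2) <= en w w.
Proof.
move=> r0 mw fw wr.
have P0 := @poincare_cst_gt0 R N s N0 r r0.
have := poincare s0 (ltW r0) mw wr; rewrite gagliardo_sqE//.
have mw2 : measurable_fun setT (fun x => w x ^+ 2) by exact: measurable_funX.
have [lty|] := ltP (\int[leb]_x (w x ^+ 2)%:E)%E +oo%E.
  have i : Rintegrable leb (fun x => w x ^+ 2).
    by apply: Rintegrable_ltP => // x; exact: sqr_ge0.
  by rewrite (Rintegral_fineK i) -EFinM lee_fin.
(* An infinite integral of w^2, multiplied by the positive constant, would force infinite energy. *)
by rewrite leye_eq => /eqP ->; rewrite gt0_muley ?lte_fin// leye_eq.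
Qed.

Lemma measurable_nonzero w : measurable_fun setT w -> measurable [set x | w x != 0].
Proof.
move=> mw; rewrite (_ : [set x | _] = w @^-1` (~` [set 0])).
  by rewrite -[X in measurable X]setTI; apply: mw => //; exact: measurableC.
by apply/seteqP; split=> x /= /eqP.
Qed.

Lemma Rintegrable_bounded_support f g : measurable_fun setT f ->
  (forall x, ~ Omega x -> f x = 0) -> Rintegrable leb g -> (forall x, `|f x| <= 1 + g x) ->
  (forall x, 0 <= g x) -> Rintegrable leb f.
Proof.
move=> mf of_ gi fg g0.
have [r r0 Or] := bounded_sub_cube Omega_bounded.
have mc := @measurable_cube R N 0 r.
have fc : (leb (cube 0 r) < +oo)%E by rewrite (lebesgue_cube _ (ltW r0)) ltry.
have ic : Rintegrable leb (\1_(cube 0 r)) by exact: Rintegrable_indic.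
apply: (Rintegrable_le mf (RintegrableD ic gi)) => x; rewrite indicE.
have [xc|/negP xc] := boolP (x \in cube 0 r); first exact: fg.
by rewrite of_ ?normr0 ?add0r// => Ox; apply: xc; apply/mem_set; exact: Or.
Qed.

(** Below the threshold t^(q-1) <= M^(q-1); above it t^(q-2) <= M^(q-2), since q < 2. *)
Lemma powR_interpolate (M t : R) : 0 < M -> 0 <= t ->
  t `^ q <= M `^ (q - 1) * t + (M `^ (2 - q))^-1 * t ^+ 2.
Proof.
move=> M0 t0.
have h1 : 0 <= (M `^ (2 - q))^-1 * t ^+ 2 by rewrite mulr_ge0 ?sqr_ge0// invr_ge0 powR_ge0.
have h2 : 0 <= M `^ (q - 1) * t by rewrite mulr_ge0 ?powR_ge0.
have [tM|Mt] := leP t M.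
  rewrite -(powR_sub1M t0 qn0); apply: (@le_trans _ _ (M `^ (q - 1) * t)); last by rewrite lerDl.
  by apply: ler_wpM2r => //; exact: powR_le_l.
have tt0 : 0 < t by exact: lt_trans Mt.
apply: (@le_trans _ _ ((M `^ (2 - q))^-1 * t ^+ 2)); last by rewrite lerDr.
have -> : t `^ q = (t `^ (2 - q))^-1 * t ^+ 2.
  rewrite -powRN -powR_mulrn// -powRD ?(lt0r_neq0 tt0) ?implybT//.
  by congr (_ `^ _); rewrite -[2%:R]/(2 : R); ring.
apply: ler_wpM2r; first exact: sqr_ge0.
rewrite lef_pV2 ?posrE ?powR_gt0//; by apply: powR_le_l => //; exact: ltW.
Qed.

Lemma eig_L1 lam u phi : eigf lam u phi -> Rintegrable leb u.
Proof.
move=> [ap _ _ _]; apply: (Rintegrable_bounded_support _ (approx_out ap) (approx_Lq ap)).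
- exact: approx_meas ap.
- move=> x; have := powR_mixed_le q1 (ler01 : 0 <= 1 :> R) (normr_ge0 (u x)).
  by rewrite !powR1 mul1r.
- by move=> x; exact: Lq_ge0.
Qed.

(** The norm |u|_q^q = 1 is interpolated between L^1 and L^2; the Poincare inequality bounds the
    L^2-part by 1/2, so the L^1-part is at least 1/2. *)
Lemma eig_L1_lower (L : R) : 0 < L -> exists2 c, 0 < c &
  forall lam u phi, lam <= L -> eigf lam u phi -> c <= \int[leb]_x `|u x|.
Proof.
move=> L0; have [r r0 Hr] := bounded_measure_poincare N0 Omega_bounded.
have P0 := @poincare_cst_gt0 R N s N0 r r0.
set P := poincare_cst s r in P0.
(* With M^(2-q) = K, the L^2-term is at most K^-1 L / P = 1/2. *)
pose K := 2 * L / P.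
have K0 : 0 < K by rewrite divr_gt0// mulr_gt0.
pose M := K `^ (2 - q)^-1.
have M0 : 0 < M by rewrite powR_gt0.
have q20 : 2 - q != 0 by rewrite subr_eq0 gt_eqF.
have MK : M `^ (2 - q) = K by rewrite -powRrM mulVf// powRr1// ltW.
pose m := M `^ (q - 1).
have m0 : 0 < m by rewrite powR_gt0.
exists ((2 * m)^-1); first by rewrite invr_gt0 mulr_gt0.
move=> lam u phi lamL eu; have [ap nu eE _] := eu.
have mu := approx_meas ap.
have iu := Rintegrable_norm (eig_L1 eu).
have [i2 P2] : Rintegrable leb (fun x => u x ^+ 2) /\
    P * \int[leb]_x (u x ^+ 2) <= en u u.
  apply: poincare_real => //; first exact: approx_en ap.
  apply: Hr; first exact: measurable_nonzero.
  by move=> x /= ux; apply: contrapT => /(approx_out ap) u0; rewrite u0 eqxx in ux.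
have le1 : 1 <= m * \int[leb]_x `|u x| + K^-1 * \int[leb]_x (u x ^+ 2).
  rewrite -nu -Rint_Z// -(Rint_Z K^-1 i2) -Rint_D; last 2 first.
  - exact: RintegrableZ.
  - exact: RintegrableZ.
  apply: Rint_le.
  - exact: approx_Lq ap.
  - by apply: RintegrableD; exact: RintegrableZ.
  - move=> x; rewrite /abs_pow -MK -[u x ^+ 2]real_normK ?num_real//.
    exact: powR_interpolate.
have le2 : K^-1 * \int[leb]_x (u x ^+ 2) <= 1 / 2.
  rewrite ler_pdivrMl// /K; rewrite -(ler_pM2l P0); apply: le_trans P2 _; rewrite eE.
  apply: le_trans lamL _; rewrite le_eqVlt; apply/orP; left; apply/eqP; field.
  by rewrite lt0r_neq0.
rewrite invfM ler_pdivrMr// mulrC.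
lra.
Qed.

End absorption_tools.

(** * The gap controls the nodal interaction *)

Definition pos_part {R : realType} {T : Type} (u : T -> R) (x : T) : R := Num.max (u x) 0.
Definition neg_part {R : realType} {T : Type} (u : T -> R) (x : T) : R := Num.max (- u x) 0.

Section parts.
Context {R : realType} {T : Type}.
Implicit Types (u : T -> R) (x : T).

Lemma pos_part_ge0 u x : 0 <= pos_part u x. Proof. by rewrite le_max lexx orbT. Qed.
Lemma neg_part_ge0 u x : 0 <= neg_part u x. Proof. by rewrite le_max lexx orbT. Qed.

Lemma partsE u x : u x = pos_part u x - neg_part u x.
Proof. by rewrite /pos_part /neg_part; have [] := leP (u x) 0; have [] := leP (- u x) 0; lra. Qed.

Lemma parts_mul u x : pos_part u x * neg_part u x = 0.
Proof.
rewrite /pos_part /neg_part; have [h|h] := leP (u x) 0; first by rewrite mul0r.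
by rewrite max_r ?mulr0// oppr_le0 ltW.
Qed.

Lemma parts_norm u x : `|u x| = pos_part u x + neg_part u x.
Proof.
rewrite /pos_part /neg_part; have [h|h] := leP (u x) 0.
  by rewrite ler0_norm// max_l ?oppr_ge0// add0r.
have h' : - u x <= 0 by rewrite oppr_le0 ltW.
by rewrite gtr0_norm// (max_r h') addr0.
Qed.

End parts.

Section spectral_gap.
Context {R : realType} {N : nat} (s q : R) (Omega : set 'rV[R]_N).
Local Notation V := 'rV[R]_N.
Local Notation leb := (@lebesgue_rV R N).
Local Notation leb2 := (leb \x leb)%E.
Local Notation gag := (gagliardo_integrand s).
Local Notation fe := (finite_energy s).
Local Notation en := (energy s).
Local Notation Lq := (abs_pow q).
Local Notation eigf := (eigenfunction s q Omega).
Implicit Types u v w f g : V -> R.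
Hypotheses (q1 : 1 < q) (q2 : q < 2).
Hypothesis Omega_bounded : bounded_set Omega.

Let q0 : 0 < q. Proof. exact: lt_trans q1. Qed.
Let qn0 : q != 0. Proof. by rewrite lt0r_neq0. Qed.

Lemma finite_energy0 : fe (fun _ : V => 0 : R).
Proof.
rewrite /finite_energy (_ : gagliardo_integrand _ _ _ = cst 0); first exact: integrable0.
by apply/funext => z; rewrite /gagliardo_integrand subrr !mul0r.
Qed.

Lemma Lq0_integrable : Rintegrable leb (Lq (fun _ : V => 0 : R)).
Proof.
rewrite (_ : abs_pow _ _ = cst 0); first exact: integrable0.
by apply/funext => x; rewrite /abs_pow normr0 powR0.
Qed.

Lemma eig_opp lam u phi : eigf lam u phi ->
  eigf lam (fun x => - 1 * u x) (fun n x => - 1 * phi n x).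
Proof.
move=> [ap nu eE weak]; have mu := approx_meas ap; split.
- exact: approximatedZ.
- by rewrite (LqZ_int _ (approx_Lq ap)).2// normrN normr1 powR1 mul1r.
- by rewrite (energyZ _ (approx_en ap)).2 eE sqrrN expr1n mul1r.
- move=> psi tpsi fpsi.
  have mpsi : measurable_fun setT psi := test_function_measurable tpsi.
  have -> : en (fun x => - 1 * u x) psi = - 1 * en u psi.
    rewrite -Rint_Z//; last exact: finite_energy_form (approx_en ap) fpsi.
    by apply: eq_Rintegral => z _; rewrite gagZ.
  have -> : weak_rhs q (fun x => - 1 * u x) psi = - 1 * weak_rhs q u psi.
    rewrite /weak_rhs -Rint_Z//; last first.
      by apply: Rintegrable_weak_rhs => //; [exact: approx_Lq ap|exact: test_function_Lq tpsi].
    by apply: eq_Rintegral => x _; rewrite normrM normrN normr1 mul1r; ring.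
  by rewrite weak//; ring.
Qed.

(** Competitors for [lambda1] are normalized exactly, the approximations of |u| only in the limit;
    this homogeneous form admits the latter. *)
Lemma lambda1_le_test phi : test_function Omega phi -> fe phi ->
  0 < \int[leb]_x Lq phi x ->
  (lambda1 Omega s q <=
    (((\int[leb]_x Lq phi x)^-1 `^ q^-1) ^+ 2 * en phi phi)%:E)%E.
Proof.
move=> tphi fphi I0; set c := _ `^ _.
have c0 : 0 <= c by exact: powR_ge0.
have iphi := test_function_Lq q1 Omega_bounded tphi.
have [fc <-] := energyZ c fphi.
rewrite -gagliardo_sqE//; apply: ereal_inf_lbound => /=.
exists (fun x => c * phi x) => //; split; first exact: test_functionZ.
have [ic Ic] := LqZ_int c iphi.
rewrite integral_out; last first.
  by move=> x Ox; rewrite (test_function_out tphi Ox) mulr0 normr0 powR0.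
rewrite (Rintegral_fineK ic) Ic ger0_norm// -powRrM mulVf// powRr1 ?invr_ge0 ?(ltW I0)//.
by rewrite mulVf// lt0r_neq0.
Qed.

Definition abs_approx (phi : nat -> V -> R) n x := smooth_abs n.+1%:R^-1 (phi n x).

(** As [smooth_abs] is 1-Lipschitz, the energy density of [eta n] lies below that of [phi n], a
    majorant with convergent integrals; so the energies converge instead of being merely
    semicontinuous. *)
Lemma approx_abs u phi : approximated s q Omega u phi ->
  let eta := abs_approx phi in
  [/\ forall n, test_function Omega (eta n), forall n, fe (eta n),
      {ae leb, forall x, eta ^~ x @ \oo --> `|u x|} &
      [/\ fe (fun x => `|u x|),
      (fun n => en (eta n) (eta n)) @ \oo --> en (fun x => `|u x|) (fun x => `|u x|) &
      (fun n => \int[leb]_x Lq (eta n) x) @ \oo --> \int[leb]_x Lq u x]].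
Proof.
move=> ap eta.
have d0 n : 0 < n.+1%:R^-1 :> R by rewrite invr_gt0.
have dl : (fun n => n.+1%:R^-1 : R) @ \oo --> (0 : R) by exact: cvg_harmonic.
have mu := approx_meas ap.
have teta n : test_function Omega (eta n).
  apply: (test_function_support (approx_test ap n)).
    by apply: smooth_smooth_abs => //; case: (approx_test ap n).
  by move=> x px; rewrite /eta /abs_approx px smooth_abs0.
have meta n : measurable_fun setT (eta n) by exact: test_function_measurable (teta n).
have aeta : {ae leb, forall x, eta ^~ x @ \oo --> `|u x|}.
  by apply: filterS (approx_ae ap) => x; exact: smooth_abs_cvg.
have gle n z : gag (eta n) (eta n) z <= gag (phi n) (phi n) z.
  by rewrite -[leRHS]mul1r -(expr1n R 2); apply: gag_sq_le => //; rewrite mul1r smooth_abs_lip.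
have feta n : fe (eta n).
  apply: (Rintegrable_le _ (approx_enn ap n)); first exact: measurable_gag.
  by move=> z; rewrite ger0_norm ?gag_ge0.
have f0 := finite_energy0; have i0 := Lq0_integrable.
have mau : measurable_fun setT (fun x => `|u x|) by exact: measurableT_comp.
have [fa ca] : fe (fun x => `|u x|) /\
    (fun n => en (eta n) (eta n)) @ \oo --> en (fun x => `|u x|) (fun x => `|u x|).
  apply: (approx_energy_limit (C := 1) ap f0) => //.
  move=> n z; rewrite mul1r ger0_norm ?gag_ge0//; apply: le_trans (gle n z) _.
  by rewrite lerDr addr_ge0 ?gag_ge0.
split=> //; split=> //.
apply: (approx_Lq_limit q1 (C := 1) (f_ := fun n => Lq (eta n)) ap i0 _ _ _ _).2.
- by move=> n; exact: measurable_Lq.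
- exact: measurable_Lq.
- apply: filterS aeta => x hx; rewrite /abs_pow -[X in X `^ _]normr_id.
  by apply: powR_cvg => //; exact: cvg_norm.
- move=> n x; rewrite mul1r ger0_norm ?Lq_ge0//.
  apply: (@le_trans _ _ (Lq (phi n) x)); last by rewrite lerDr addr_ge0 ?Lq_ge0.
  apply: powR_le_l => //; first exact: ltW.
  by rewrite ger0_norm ?smooth_abs_ge0// smooth_abs_le.
Qed.

(** |u| need not be a smooth competitor; its regularizations are, after rescaling by factors that
    tend to 1. *)
Lemma lambda1_le_abs lam u phi : eigf lam u phi ->
  (lambda1 Omega s q <= (en (fun x => `|u x|) (fun x => `|u x|))%:E)%E.
Proof.
move=> [ap nu _ _].
have [teta feta aeta [fa cen cL]] := approx_abs ap.
set eta := abs_approx phi in teta feta aeta cen cL.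
rewrite nu in cL.
pose b n := ((\int[leb]_x Lq (eta n) x)^-1 `^ q^-1) ^+ 2 * en (eta n) (eta n).
have cb : b @ \oo --> en (fun x => `|u x|) (fun x => `|u x|).
  have c1 : (fun n => (\int[leb]_x Lq (eta n) x)^-1) @ \oo --> (1 : R).
    by rewrite -[X in _ --> X]invr1; apply: cvgV => //; exact: oner_neq0.
  have c2 : (fun n => (\int[leb]_x Lq (eta n) x)^-1 `^ q^-1) @ \oo --> (1 : R).
    have p1 : (1 : R) `^ q^-1 = 1 by rewrite powR1.
    rewrite -[X in _ --> X]p1; apply: powR_cvg => //; first by rewrite invr_gt0.
    by move=> n; rewrite invr_ge0 Rintegral_ge0// => x _; exact: Lq_ge0.
  have c3 := cvgM (cvgM c2 c2) cen; rewrite !mul1r in c3; exact: c3.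
have [M _ HM] : \forall n \near \oo, 0 < \int[leb]_x Lq (eta n) x.
  by apply: (cvgr_gt _ cL); exact: ltr01.
have le n : (M <= n)%N -> (lambda1 Omega s q <= (b n)%:E)%E.
  by move=> Mn; apply: lambda1_le_test => //; exact: HM.
have : (lambda1 Omega s q <= lim ((b n)%:E @[n --> \oo]))%E.
  apply: lime_ge; last by exists M => // n /=; exact: le.
  by apply/cvg_ex; exists (en (fun x => `|u x|) (fun x => `|u x|))%:E; apply: cvg_EFin => //; exact: nearW.
suff -> : lim ((b n)%:E @[n --> \oo]) = (en (fun x => `|u x|) (fun x => `|u x|))%:E by [].
by apply/cvg_lim => //; apply: cvg_EFin => //; exact: nearW.
Qed.

Lemma eig_parts_integrable lam u phi : eigf lam u phi ->
  [/\ Rintegrable leb (pos_part u), Rintegrable leb (neg_part u) &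
   \int[leb]_x `|u x| = \int[leb]_x pos_part u x + \int[leb]_x neg_part u x].
Proof.
move=> eu; have iu := eig_L1 q1 Omega_bounded eu; have mu := Rintegrable_measurable iu.
have ip : Rintegrable leb (pos_part u).
  apply: (Rintegrable_le _ (Rintegrable_norm iu)); first exact: measurable_maxr.
  by move=> x; rewrite (parts_norm u) ger0_norm ?pos_part_ge0// lerDl neg_part_ge0.
have im : Rintegrable leb (neg_part u).
  apply: (Rintegrable_le _ (Rintegrable_norm iu)).
    by apply: measurable_maxr => //; exact: measurableT_comp.
  by move=> x; rewrite (parts_norm u) ger0_norm ?neg_part_ge0// lerDr pos_part_ge0.
split => //; rewrite -Rint_D//; apply: eq_Rintegral => x _; exact: parts_norm.
Qed.

(* Opposite signs at x and y make (u x - u y)^2 larger than (|u x| - |u y|)^2 by 4 |u x| |u y|. *)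
Lemma eig_gap (k : R) lam u phi : 0 <= k ->
  (forall x y, Omega x -> Omega y -> x != y -> k <= gagliardo_kernel s (x, y)) ->
  eigf lam u phi ->
  (lambda1 Omega s q + (4 * k * (\int[leb]_x pos_part u x * \int[leb]_x neg_part u x))%:E
     <= lam%:E)%E.
Proof.
move=> k0 hk eu; have [ap nu eE _] := eu; have le1 := lambda1_le_abs eu.
have [_ _ _ [fa _ _]] := approx_abs ap.
have [ip im _] := eig_parts_integrable eu.
have fu := approx_en ap.
have [iP PE] := Rintegrable_prod ip im (pos_part_ge0 u) (neg_part_ge0 u).
apply: le_trans (leeD2r _ le1) _; rewrite -EFinD lee_fin -eE -PE -Rint_Z// -Rint_D//; last first.
  exact: RintegrableZ.
apply: Rint_le => //; first by apply: RintegrableD => //; exact: RintegrableZ.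
move=> [x y] /=; rewrite /gagliardo_integrand /= (parts_norm u x) (parts_norm u y) (partsE u x) (partsE u y).
have out := approx_out ap.
have := pos_part_ge0 u x; have := pos_part_ge0 u y.
have := neg_part_ge0 u x; have := neg_part_ge0 u y.
have := parts_mul u x; have := parts_mul u y.
have := gagliardo_kernel_ge0 s (x, y).
(* If the product is nonzero, both points lie in Omega, and they differ because the two parts have
   disjoint supports; otherwise both sides vanish. *)
have : pos_part u x * neg_part u y * k <= pos_part u x * neg_part u y * gagliardo_kernel s (x, y).
  have [z0|pn0] := eqVneq (pos_part u x * neg_part u y) 0; first by rewrite z0 !mul0r.
  apply: ler_wpM2l; first by rewrite mulr_ge0 ?pos_part_ge0 ?neg_part_ge0.
  apply: hk.
  - by apply: contrapT => /out ux; move: pn0; rewrite /pos_part ux maxxx mul0r eqxx.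
  - by apply: contrapT => /out uy; move: pn0; rewrite /neg_part uy oppr0 maxxx mulr0 eqxx.
  - by apply: contra_neq pn0 => ->; exact: parts_mul.
set K := gagliardo_kernel s _; set a := pos_part u x; set b := pos_part u y.
set a' := neg_part u x; set b' := neg_part u y.
move=> h K0 bb aa b'0 a'0 b0 a0.
have e : (a - a' - (b - b')) * (a - a' - (b - b')) * K =
   (a + a' - (b + b')) * (a + a' - (b + b')) * K + 4 * (a * b' * K) + 4 * (a' * b * K).
  (* The identity needs a a' = b b' = 0: a zero multiple of K is added and rewritten with a a' + b
     b', which leaves a polynomial identity. *)
  rewrite -[RHS]addr0 -[X in _ = _ + X](mulr0 (- 4 * K)) -[X in _ = _ + _ * X](addr0 0).
  by rewrite -{1}aa -bb; ring.
(* The symmetric interaction a' b is discarded, so the constant is 4 where 8 would be sharp. *)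
rewrite e; have : 0 <= a' * b * K by rewrite !mulr_ge0.
by lra.
Qed.

End spectral_gap.

(** * The equation tested with the negative part *)

Section constant_sign.
Context {R : realType} {N : nat} (s q : R) (Omega : set 'rV[R]_N).
Local Notation V := 'rV[R]_N.
Local Notation leb := (@lebesgue_rV R N).
Local Notation leb2 := (leb \x leb)%E.
Local Notation gag := (gagliardo_integrand s).
Local Notation fe := (finite_energy s).
Local Notation en := (energy s).
Local Notation Lq := (abs_pow q).
Local Notation eigf := (eigenfunction s q Omega).
Implicit Types u v w f g : V -> R.
Hypotheses (q1 : 1 < q) (q2 : q < 2).
Hypothesis Omega_bounded : bounded_set Omega.

Let q0 : 0 < q. Proof. exact: lt_trans q1. Qed.
Let qn0 : q != 0. Proof. by rewrite lt0r_neq0. Qed.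

Let half_lip (a b c d : R) : `|a - b| <= `|c - d| ->
  `|2^-1 * (a - c) - 2^-1 * (b - d)| <= `|c - d|.
Proof.
move=> h; rewrite -mulrBr (_ : a - c - (b - d) = (a - b) - (c - d)); last by ring.
rewrite normrM ger0_norm ?invr_ge0// ler_pdivrMl//.
by apply: le_trans (ler_normB _ _) _; lra.
Qed.

Lemma neg_partE u x : neg_part u x = 2^-1 * (`|u x| - u x).
Proof. by rewrite (parts_norm u) (partsE u x); field. Qed.

Lemma neg_part_lip u x y : `|neg_part u x - neg_part u y| <= `|u x - u y|.
Proof. by rewrite !neg_partE half_lip// ler_dist_dist. Qed.

Lemma Lq_neg_part u x : `|u x| `^ (q - 2) * u x * neg_part u x = - Lq (neg_part u) x.
Proof.
rewrite /abs_pow /neg_part; have [h|h] := leP (- u x) 0.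
  by rewrite mulr0 normr0 powR0// oppr0.
by have := congr1 (@^~ x) (weak_rhs_diag q1 u); rewrite /abs_pow /= mulrN normrN => ->.
Qed.

Lemma Lq_neg_part_le u x : Lq (neg_part u) x <= Lq u x.
Proof.
apply: powR_le_l => //; first exact: ltW.
by rewrite ger0_norm ?neg_part_ge0// (parts_norm u) lerDr pos_part_ge0.
Qed.

(* Testing the equation with the negative part v of u: the nonlocal interaction of
   u^+ and v yields the additional L^1-term on the left. *)
Lemma eig_neg_part (k : R) lam u phi : 0 <= k ->
  (forall x y, Omega x -> Omega y -> x != y -> k <= gagliardo_kernel s (x, y)) ->
  eigf lam u phi ->
  [/\ fe (neg_part u), Rintegrable leb (Lq (neg_part u)) &
  en (neg_part u) (neg_part u) + k * (\int[leb]_x pos_part u x * \int[leb]_x neg_part u x)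
   <= lam * \int[leb]_x Lq (neg_part u) x].
Proof.
move=> k0 hk eu; have [ap _ _ _] := eu.
have mu := approx_meas ap.
have [ip im _] := eig_parts_integrable q1 Omega_bounded eu.
have mv := Rintegrable_measurable im.
have [teta feta aeta _] := approx_abs q1 ap.
set eta := abs_approx phi in teta feta aeta.
have d0 n : 0 < n.+1%:R^-1 :> R by rewrite invr_gt0.
(* The negative part is (|u| - u) / 2; replacing |u| by its regularization keeps [psi n] smooth, and
   its increments and values stay bounded by those of [phi n]. *)
pose psi n x := 2^-1 * (eta n x - phi n x).
have tpsi n : test_function Omega (psi n).
  apply: (test_function_support (approx_test ap n)).
    apply: smoothM; first exact: smooth_cst.
    apply: smoothD; first by case: (teta n).
    rewrite (_ : (fun x => _) = fun x => - 1 * phi n x); last by apply/funext => x; rewrite mulN1r.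
    by apply: smoothM; [exact: smooth_cst|case: (approx_test ap n)].
  by move=> x px; rewrite /psi /eta /abs_approx px smooth_abs0// subrr mulr0.
have etalip n x y : `|eta n x - eta n y| <= `|phi n x - phi n y| by exact: smooth_abs_lip.
have fv : fe (neg_part u).
  apply: (Rintegrable_le _ (approx_en ap)); first exact: measurable_gag.
  move=> z; rewrite ger0_norm ?gag_ge0// -[leRHS]mul1r -(expr1n R 2).
  by apply: gag_sq_le => //; rewrite mul1r neg_part_lip.
have iv : Rintegrable leb (Lq (neg_part u)).
  apply: (Rintegrable_le _ (approx_Lq ap)); first exact: measurable_Lq.
  by move=> x; rewrite ger0_norm ?Lq_ge0// Lq_neg_part_le.
have [iE iW E] : [/\ Rintegrable leb2 (gag u (neg_part u)),
      Rintegrable leb (fun x => `|u x| `^ (q - 2) * u x * neg_part u x) &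
      en u (neg_part u) = lam * weak_rhs q u (neg_part u)].
  apply: (eig_weak_limit q1 q2 (psi_ := psi) (C := 1) eu (finite_energy0 s) (Lq0_integrable q1)) => //.
  - apply: filterS2 aeta (approx_ae ap) => x h1 h2; rewrite neg_partE.
    by apply: cvgMr; exact: cvgB.
  - by move=> n x y; rewrite subrr normr0 add0r mul1r; exact: half_lip.
  - move=> n x; rewrite normr0 add0r mul1r /psi -[eta n x]subr0 -[phi n x in X in _ <= X]subr0.
    have := @half_lip (eta n x) 0 (phi n x) 0; rewrite !subr0 mulr0 subr0; apply.
    by rewrite ger0_norm ?smooth_abs_ge0// smooth_abs_le.
split => //.
have WE : weak_rhs q u (neg_part u) = - \int[leb]_x Lq (neg_part u) x.
  rewrite -mulN1r -Rint_Z//; apply: eq_Rintegral => x _.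
  by rewrite Lq_neg_part mulN1r.
have [iP PE] := Rintegrable_prod ip im (pos_part_ge0 u) (neg_part_ge0 u).
(* Pairing u with its negative part gives minus signs on both sides of the equation; they are
   removed before the integrands are compared. *)
rewrite -[leRHS]opprK -mulrN -WE -E -PE -mulN1r -(Rint_Z _ iE) -(Rint_Z _ iP) -Rint_D//; last first.
  exact: RintegrableZ.
apply: Rint_le; [by apply: RintegrableD => //; exact: RintegrableZ|exact: RintegrableZ|].
move=> [x y] /=; rewrite /gagliardo_integrand /=.
rewrite [in leRHS](partsE u x) [in leRHS](partsE u y).
have out := approx_out ap.
have := pos_part_ge0 u x; have := pos_part_ge0 u y.
have := neg_part_ge0 u x; have := neg_part_ge0 u y.
have := gagliardo_kernel_ge0 s (x, y).
have : pos_part u x * neg_part u y * k <= pos_part u x * neg_part u y * gagliardo_kernel s (x, y).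
  have [z0|pn0] := eqVneq (pos_part u x * neg_part u y) 0; first by rewrite z0 !mul0r.
  apply: ler_wpM2l; first by rewrite mulr_ge0 ?pos_part_ge0 ?neg_part_ge0.
  apply: hk.
  - by apply: contrapT => /out ux; move: pn0; rewrite /pos_part ux maxxx mul0r eqxx.
  - by apply: contrapT => /out uy; move: pn0; rewrite /neg_part uy oppr0 maxxx mulr0 eqxx.
  - by apply: contra_neq pn0 => ->; exact: parts_mul.
have := parts_mul u x; have := parts_mul u y.
set K := gagliardo_kernel s _; set a := pos_part u x; set b := pos_part u y.
set a' := neg_part u x; set b' := neg_part u y.
move=> bb aa h K0 b'0 a'0 b0 a0.
have e : - 1 * ((a - a' - (b - b')) * (a' - b') * K) =
   (a' - b') * (a' - b') * K + a * b' * K + a' * b * K.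
  rewrite -[RHS]subr0 -[X in _ = _ - X](mulr0 K) -[X in _ = _ - _ * X](addr0 0).
  by rewrite -{1}aa -bb; ring.
rewrite e; have : 0 <= a' * b * K by rewrite !mulr_ge0.
by lra.
Qed.

End constant_sign.

(** * Absorption of the negative part *)

Section absorption.
Context {R : realType} {N : nat} (s q : R) (Omega : set 'rV[R]_N).
Local Notation V := 'rV[R]_N.
Local Notation leb := (@lebesgue_rV R N).
Local Notation leb2 := (leb \x leb)%E.
Local Notation gag := (gagliardo_integrand s).
Local Notation fe := (finite_energy s).
Local Notation en := (energy s).
Local Notation Lq := (abs_pow q).
Local Notation eigf := (eigenfunction s q Omega).
Implicit Types u v w f g : V -> R.
Hypotheses (N0 : (0 < N)%N) (s0 : 0 < s) (q1 : 1 < q) (q2 : q < 2).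
Hypothesis Omega_bounded : bounded_set Omega.

Let q0 : 0 < q. Proof. exact: lt_trans q1. Qed.
Let qn0 : q != 0. Proof. by rewrite lt0r_neq0. Qed.

(** The truncation level is tau/2 so that t <= 2 [excess tau t] as soon as t > tau; this is the
    source of the factor 4 in [powR_excess_le]. *)
Definition excess (tau t : R) : R := Num.max (t - tau / 2) 0.

Lemma excess_lip (tau t t' : R) : `|excess tau t - excess tau t'| <= `|t - t'|.
Proof.
rewrite /excess; have := ler_norm (t - t'); have := ler_norm (t' - t).
rewrite [`|t' - _|]distrC; move: `|t - t'| => n h1 h2; rewrite ler_norml.
by have [? |?] := leP (t - tau / 2) 0; have [? |?] := leP (t' - tau / 2) 0;
  apply/andP; split; lra.
Qed.

Lemma powR_excess_le (tau t : R) : 0 < tau -> 0 <= t ->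
  t `^ q <= tau `^ (q - 1) * t + 4 * (tau `^ (2 - q))^-1 * excess tau t ^+ 2.
Proof.
move=> tau0 t0.
have q10 : 0 <= q - 1 by rewrite subr_ge0 ltW.
have q20 : 0 <= 2 - q by rewrite subr_ge0 ltW.
have c0 : 0 <= (tau `^ (2 - q))^-1 by rewrite invr_ge0 powR_ge0.
have e0 : 0 <= excess tau t by rewrite le_max lexx orbT.
have h2 : 0 <= 4 * (tau `^ (2 - q))^-1 * excess tau t ^+ 2 by rewrite !mulr_ge0// sqr_ge0.
have [tM|Mt] := leP t tau.
  apply: (@le_trans _ _ (tau `^ (q - 1) * t)); last by rewrite lerDl.
  by rewrite -(powR_sub1M t0 qn0); apply: ler_wpM2r => //; exact: powR_le_l.
have tt0 : 0 < t by exact: lt_trans Mt.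
have -> : t `^ q = (t `^ (2 - q))^-1 * t ^+ 2.
  rewrite -powRN -powR_mulrn// -powRD ?(lt0r_neq0 tt0) ?implybT//.
  by congr (_ `^ _); rewrite -[2%:R]/(2 : R); ring.
apply: (@le_trans _ _ (4 * (tau `^ (2 - q))^-1 * excess tau t ^+ 2)); last first.
  by rewrite lerDr mulr_ge0 ?powR_ge0.
rewrite [4 * _]mulrC -mulrA; apply: ler_pM; rewrite ?invr_ge0 ?powR_ge0 ?sqr_ge0//.
  by rewrite lef_pV2 ?posrE ?powR_gt0//; apply: powR_le_l => //; exact: ltW.
have : t - tau / 2 <= excess tau t by rewrite le_max lexx.
by move=> ?; nra.
Qed.

(** Chebyshev's inequality at the level tau/2; boundedness of Omega gives the finite measure that
    makes the indicator integrable. *)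
Lemma excess_measure_le v (tau : R) : 0 < tau -> Rintegrable leb v -> (forall x, 0 <= v x) ->
  (forall x, ~ Omega x -> v x = 0) ->
  (leb [set x | (excess tau (v x) != 0)%R] <= (2 / tau * \int[leb]_x v x)%:E)%E.
Proof.
move=> tau0 iv v0 ov; have mv := Rintegrable_measurable iv.
have me : measurable_fun setT (fun x => excess tau (v x)).
  by apply: measurable_maxr => //; apply: measurable_funB.
set A := [set x | _].
have mA : measurable A by exact: measurable_nonzero me.
have hA x : A x -> tau / 2 < v x.
  rewrite /A /= /excess; have [h|h] := leP (v x - tau / 2) 0; first by rewrite eqxx.
  by move=> _; lra.
have AO : A `<=` Omega.
  move=> x /hA h; apply: contrapT => /ov v0x; move: h; rewrite v0x ltNge => /negP; apply.
  by rewrite divr_ge0// ltW.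
have [r r0 Hr] := bounded_measure_poincare N0 Omega_bounded.
have fA : (leb A < +oo)%E by apply: le_lt_trans (Hr _ mA AO) (ltry _).
have iA : Rintegrable leb (\1_A : V -> R) by exact: Rintegrable_indic.
have IA : ((\int[leb]_x (\1_A x))%:E = leb A)%E.
  by rewrite -(Rintegral_fineK iA) integral_indic// setIT.
rewrite -IA lee_fin -Rint_Z//; apply: Rint_le => //; first exact: RintegrableZ.
move=> x; rewrite indicE; have [/set_mem/hA h|_] := boolP (x \in A).
  by rewrite -ler_pdivrMl ?divr_gt0// mulr1 invf_div ltW.
by rewrite mulr_ge0// divr_ge0// ltW.
Qed.

(* On {v <= tau} the term lam v^q is absorbed by the L^1-term of eig_neg_part; {v > tau}
   has small measure, so there it is absorbed by [v]^2 through the Poincare inequality. *)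
Lemma eig_constant_sign (L : R) : 0 < L -> exists2 d : R, 0 < d &
  forall lam u phi, lam <= L -> (lam%:E < lambda1 Omega s q + d%:E)%E -> eigf lam u phi ->
  exists u' phi', eigf lam u' phi' /\ {ae leb, forall x, neg_part u' x = 0}.
Proof.
move=> L0.
have [c c0 Hc] := eig_L1_lower N0 s0 q1 q2 Omega_bounded L0.
have [k k0 hk] := kernel_lb_bounded N0 s0 Omega_bounded.
(* One of the two parts of u has integral at least c/2; if it is the positive one, the interaction
   term is at least c1 times the integral of the negative part. *)
pose c1 := k * c / 2.
have c10 : 0 < c1 by rewrite divr_gt0// mulr_gt0.
have q10 : q - 1 != 0 by rewrite subr_eq0 gt_eqF.
(* Chosen so that L tau^(q-1) = c1: below [tau] the right-hand side is exactly balanced by the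
   L^1-term. *)
pose tau := (c1 / L) `^ (q - 1)^-1.
have tau0 : 0 < tau by rewrite powR_gt0// divr_gt0.
have tauE : tau `^ (q - 1) = c1 / L by rewrite -powRrM mulVf// powRr1// divr_ge0// ltW.
pose A := 4 * L * (tau `^ (2 - q))^-1.
have A0 : 0 < A by rewrite !mulr_gt0// invr_gt0 powR_gt0.
(* A Poincare constant of at least 2A bounds the part above [tau] by half of [v]^2. *)
have [r r0 hr] := poincare_cst_large N0 s0 (2 * A).
pose m : R := (2 * r) ^+ N / 2.
have m0 : 0 < m by rewrite divr_gt0// exprn_gt0// mulr_gt0.
exists (m * tau * c1); first exact: mulr_gt0 (mulr_gt0 m0 tau0) c10.
have main lam u phi : lam <= L -> (lam%:E < lambda1 Omega s q + (m * tau * c1)%:E)%E ->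
    eigf lam u phi -> c / 2 <= \int[leb]_x pos_part u x ->
    {ae leb, forall x, neg_part u x = 0}.
  move=> lamL lamd eu cu.
  have k0' := ltW k0.
  have gap := eig_gap q1 Omega_bounded k0' hk eu.
  have [ap _ _ _] := eu.
  have [ip im _] := eig_parts_integrable q1 Omega_bounded eu.
  have mv := Rintegrable_measurable im.
  have [fv iv ineq] := eig_neg_part q1 q2 Omega_bounded k0' hk eu.
  set v := neg_part u in im mv fv iv ineq *.
  have v0 x : 0 <= v x by exact: neg_part_ge0.
  have ov x : ~ Omega x -> v x = 0.
    by move=> /(approx_out ap) ux; rewrite /v /neg_part ux oppr0 maxxx.
  set a := \int[leb]_x pos_part u x in gap ineq cu.
  set b := \int[leb]_x v x in gap ineq.
  have b0 : 0 <= b by exact: Rintegral_ge0.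
  have small : 4 * k * (a * b) < m * tau * c1.
    have := le_lt_trans gap lamd; case: (lambda1 Omega s q) => [l| |] //=.
    by rewrite -!EFinD lte_fin ltrD2l.
  have kab : c1 * b <= k * (a * b).
    by rewrite mulrA ler_wpM2r// /c1 -mulrA ler_wpM2l.
  have small_b : 2 / tau * b <= m.
    (* The gap gives b < m tau / 4, so the measure of the support, at most 2b / tau, stays below the
       [m] required by [poincare]. *)
    have : 4 * (c1 * b) < m * tau * c1.
      by apply: le_lt_trans small; rewrite -[4 * k * _]mulrA ler_wpM2l.
    rewrite (_ : 4 * (c1 * b) = 4 * b * c1); last by ring.
    rewrite ltr_pM2r// => h; rewrite mulrAC ler_pdivrMr//.
    by lra.
  pose w x := excess tau (v x).
  have mw : measurable_fun setT w.
    by apply: measurable_maxr => //; apply: measurable_funB.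
  have wlip x y : `|w x - w y| <= `|v x - v y| by exact: excess_lip.
  have gw z : gag w w z <= gag v v z.
    by rewrite -[leRHS]mul1r -(expr1n R 2); apply: gag_sq_le => //; rewrite mul1r.
  have fw : fe w.
    apply: (Rintegrable_le _ fv); first exact: measurable_gag.
    by move=> z; rewrite ger0_norm ?gag_ge0.
  have enw : en w w <= en v v by exact: Rint_le.
  have [iw2 Pw] : Rintegrable leb (fun x => w x ^+ 2) /\
      @poincare_cst R N s r * \int[leb]_x (w x ^+ 2) <= en w w.
    apply: poincare_real => //.
    apply: le_trans (excess_measure_le tau0 im v0 ov) _.
    by rewrite lee_fin.
  set W := \int[leb]_x (w x ^+ 2) in Pw.
  have W0 : 0 <= W by apply: Rintegral_ge0 => x _; exact: sqr_ge0.
  have lamv : lam * \int[leb]_x Lq v x <= c1 * b + A * W.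
    apply: (@le_trans _ _ (L * \int[leb]_x Lq v x)).
      by apply: ler_wpM2r => //; apply: Rintegral_ge0 => x _; exact: Lq_ge0.
    rewrite /b /W -(Rint_Z _ im) -(Rint_Z _ iw2) -(Rint_Z _ iv) -Rint_D; last 2 first.
    - exact: RintegrableZ.
    - exact: RintegrableZ.
    apply: Rint_le; first exact: RintegrableZ.
      by apply: RintegrableD; exact: RintegrableZ.
    move=> x; rewrite /abs_pow ger0_norm//.
    have := powR_excess_le tau0 (v0 x); rewrite tauE -(ler_pM2l L0) => /le_trans; apply.
    rewrite le_eqVlt; apply/orP; left; apply/eqP; rewrite /A /w; field.
    by rewrite !lt0r_neq0// powR_gt0.
  (* The two L^1-terms cancel; with 2 A W <= [v]^2 this forces [v]^2 = 0. *)
  have enA : en v v <= A * W by lra.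
  have AW : 2 * A * W <= en v v.
    apply: le_trans enw; apply: le_trans Pw; exact: ler_wpM2r.
  have AW0 : 0 <= A * W by rewrite mulr_ge0// ltW.
  have env0 : en v v <= 0 by lra.
  have [r' r'0 Hr'] := bounded_measure_poincare N0 Omega_bounded.
  have P'0 := @poincare_cst_gt0 R N s N0 r' r'0.
  have [iv2 Pv] : Rintegrable leb (fun x => v x ^+ 2) /\
      @poincare_cst R N s r' * \int[leb]_x (v x ^+ 2) <= en v v.
    apply: poincare_real => //; apply: Hr'; first exact: measurable_nonzero.
    by move=> x /= vx; apply: contrapT => /ov v0x; rewrite v0x eqxx in vx.
  have : \int[leb]_x (v x ^+ 2) <= 0.
    by rewrite -(ler_pM2l P'0) mulr0; exact: le_trans env0.
  move/(Rint_eq0 iv2 (fun x => sqr_ge0 (v x))); apply: filterS => x.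
  by move/eqP; rewrite sqrf_eq0 => /eqP.
move=> lam u phi lamL lamd eu.
have := Hc _ _ _ lamL eu; have [_ _ ->] := eig_parts_integrable q1 Omega_bounded eu => cu.
have [big|sm] := leP (c / 2) (\int[leb]_x pos_part u x).
  by exists u, phi; split => //; exact: main eu big.
have eu' := eig_opp q1 q2 Omega_bounded eu.
exists (fun x => - 1 * u x), (fun n x => - 1 * phi n x); split => //.
apply: (main _ _ _ lamL lamd eu').
have -> : \int[leb]_x pos_part (fun x => - 1 * u x) x = \int[leb]_x neg_part u x.
  by apply: eq_Rintegral => x _; rewrite /pos_part /neg_part mulN1r.
by lra.
Qed.

End absorption.

(** * Nonnegative eigenfunctions are minimizers *)

Section scalar_inequalities.
Context {R : realType}.
Implicit Types a b e p t : R.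

(** The increment bound that [eig_weak_limit] asks of zeta^2 / (e + eta), with F and G the
    denominators at two points. *)
Lemma square_quotient_lip (M e : R) (a b F G : R) : 0 < e -> `|a| <= M -> `|b| <= M ->
  e <= F -> e <= G ->
  `|a * a * F^-1 - b * b * G^-1| <= (2 * M / e + M ^+ 2 / e ^+ 2) * (`|a - b| + `|F - G|).
Proof.
move=> e0 aM bM eF eG.
have M0 : 0 <= M by exact: le_trans aM.
have F0 : 0 < F by exact: lt_le_trans eF.
have G0 : 0 < G by exact: lt_le_trans eG.
have -> : a * a * F^-1 - b * b * G^-1 =
    (a - b) * ((a + b) * F^-1) - (F - G) * (b ^+ 2 * (F^-1 * G^-1)).
  by field; rewrite !lt0r_neq0.
have Fe : F^-1 <= e^-1 by rewrite lef_pV2 ?posrE.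
have Ge : G^-1 <= e^-1 by rewrite lef_pV2 ?posrE.
have F'0 : 0 <= F^-1 by rewrite invr_ge0 ltW.
have G'0 : 0 <= G^-1 by rewrite invr_ge0 ltW.
have h1 : `|(a + b) * F^-1| <= 2 * M / e.
  rewrite normrM (ger0_norm F'0); apply: ler_pM => //.
  by apply: le_trans (ler_normD _ _) _; lra.
have h2 : `|b ^+ 2 * (F^-1 * G^-1)| <= M ^+ 2 / e ^+ 2.
  rewrite normrM normrX (ger0_norm (mulr_ge0 F'0 G'0)); apply: ler_pM => //.
  - exact: mulr_ge0.
  - by rewrite ler_pXn2r ?nnegrE.
  - by rewrite -exprVn expr2; apply: ler_pM.
apply: le_trans (ler_normB _ _) _; rewrite (normrM (a - b)) (normrM (F - G)) mulrDr; apply: lerD.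
  rewrite mulrC; apply: ler_wpM2r => //; apply: le_trans h1 _.
  by rewrite lerDl divr_ge0// ?sqr_ge0.
rewrite mulrC; apply: ler_wpM2r => //; apply: le_trans h2 _.
by rewrite lerDr divr_ge0 ?mulr_ge0// ltW.
Qed.

(** With A = e + a and B = e + b, one has a - b = A - B, and the difference of the two sides is (pB
    - tA)^2 / (AB). *)
Lemma picone a b e p t : 0 <= a -> 0 <= b -> 0 < e ->
  (a - b) * (p * p * (e + a)^-1 - t * t * (e + b)^-1) <= (p - t) * (p - t).
Proof.
move=> a0 b0 e0.
have A0 : 0 < e + a by rewrite ltr_pwDl.
have B0 : 0 < e + b by rewrite ltr_pwDl.
rewrite -subr_ge0.
have -> : (p - t) * (p - t) - (a - b) * (p * p * (e + a)^-1 - t * t * (e + b)^-1) =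
    (p * (e + b) - t * (e + a)) ^+ 2 * ((e + a)^-1 * (e + b)^-1).
  by field; rewrite !lt0r_neq0.
by rewrite mulr_ge0 ?sqr_ge0// mulr_ge0// invr_ge0 ltW.
Qed.

(** At b = 0 the product contains -a t^2 / e; half of it can be spared, at the cost of p^2. *)
Lemma picone_zero a e p t : 0 <= a -> 0 < e ->
  (a - 0) * (p * p * (e + a)^-1 - t * t * (e + 0)^-1) + ((2 * e)^-1 * a * t ^+ 2 - p ^+ 2)
    <= 0.
Proof.
move=> a0 e0.
have A0 : 0 < e + a by rewrite ltr_pwDl.
have -> : (a - 0) * (p * p * (e + a)^-1 - t * t * (e + 0)^-1) + ((2 * e)^-1 * a * t ^+ 2 - p ^+ 2)
    = - (e * p ^+ 2 * (e + a)^-1 + (2 * e)^-1 * a * t ^+ 2).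
  by rewrite addr0 subr0; field; rewrite !lt0r_neq0.
have e2 : 0 <= (2 * e)^-1 by rewrite invr_ge0 mulr_ge0// ltW.
rewrite oppr_le0; apply: addr_ge0.
  exact: divr_ge0 (mulr_ge0 (ltW e0) (sqr_ge0 p)) (ltW A0).
exact: mulr_ge0 (mulr_ge0 e2 a0) (sqr_ge0 t).
Qed.

(** Young's inequality with exponents 2/q and 2/(2-q), applied to (t/a)^q and 1. The first term is
    written in the shape of the weak right-hand side tested with t^2 / a. *)
Lemma powR_young (q a t : R) : 1 < q -> q < 2 -> 0 < a -> 0 <= t ->
  t `^ q <= q / 2 * (a `^ (q - 2) * a * (t ^+ 2 / a)) + (1 - q / 2) * a `^ q.
Proof.
move=> q1 q2 a0 t0.
have q0 : 0 < q by lra.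
pose x := t / a; have x0 : 0 <= x by rewrite divr_ge0// ltW.
have -> : t = x * a by rewrite /x divfK// lt0r_neq0.
have -> : a `^ (q - 2) * a * ((x * a) ^+ 2 / a) = x ^+ 2 * a `^ q.
  rewrite (_ : a `^ q = a `^ (q - 2) * a ^+ 2); first by field; rewrite lt0r_neq0.
  rewrite -(powR_mulrn 2 (ltW a0)) -powRD ?(lt0r_neq0 a0) ?implybT//.
  by congr (_ `^ _); rewrite -[2%:R]/(2 : R); ring.
rewrite powRM ?(ltW a0)// mulrA -mulrDl; apply: ler_wpM2r; first exact: powR_ge0.
have := @conjugate_powR R (x `^ q) 1 (2 / q) (2 / (2 - q)).
rewrite mulr1 powR1 powR_ge0 ler01 !divr_gt0 ?subr_gt0// => h.
have {}h := h isT isT isT isT.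
have e1 : (2 / q)^-1 = q / 2 by rewrite invf_div.
have e2 : (2 / (2 - q))^-1 = 1 - q / 2.
  by rewrite invf_div; field.
apply: le_trans (h _) _; first by rewrite e1 e2; ring.
rewrite e1 e2 mul1r -powRrM (_ : q * (2 / q) = 2%:R); last first.
  by rewrite mulrCA mulfV ?mulr1// lt0r_neq0.
by rewrite powR_mulrn// mulrC.
Qed.

End scalar_inequalities.

Lemma measurable_inv_pos {d} {T : measurableType d} {R : realType} (f : T -> R) :
  measurable_fun setT f -> (forall x, 0 <= f x) -> measurable_fun setT (fun x => (f x)^-1).
Proof.
move=> mf f0; rewrite (_ : (fun x => _) = fun x => f x `^ (-1)); last first.
  by apply/funext => x; rewrite powR_inv1.
exact: (measurableT_comp (measurable_powR _) mf).
Qed.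

Section nonnegative_eigenfunctions.
Context {R : realType} {N : nat} (s q : R) (Omega : set 'rV[R]_N).
Local Notation V := 'rV[R]_N.
Local Notation leb := (@lebesgue_rV R N).
Local Notation leb2 := (leb \x leb)%E.
Local Notation gag := (gagliardo_integrand s).
Local Notation fe := (finite_energy s).
Local Notation en := (energy s).
Local Notation Lq := (abs_pow q).
Local Notation eigf := (eigenfunction s q Omega).
Implicit Types u v w f g : V -> R.
Hypotheses (N0 : (0 < N)%N) (s0 : 0 < s) (q1 : 1 < q) (q2 : q < 2).
Hypothesis Omega_bounded : bounded_set Omega.

Let q0 : 0 < q. Proof. exact: lt_trans q1. Qed.
Let qn0 : q != 0. Proof. by rewrite lt0r_neq0. Qed.

(** The modulus keeps the denominator at least [e] even on the null set where a nonnegative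
    eigenfunction may be negative. *)
Definition picone_test (e : R) u zeta (x : V) : R := zeta x * zeta x * (e + `|u x|)^-1.

(** Replacing |u| by its regularizations gives test functions, and denominators bounded below by [e]
    give the Lipschitz control. The sign of u does not enter. *)
Lemma eig_picone_test lam u phi zeta (e : R) : 0 < e -> eigf lam u phi ->
  test_function Omega zeta -> fe zeta ->
  [/\ Rintegrable leb2 (gag u (picone_test e u zeta)),
      Rintegrable leb (fun x => `|u x| `^ (q - 2) * u x * picone_test e u zeta x) &
      en u (picone_test e u zeta) = lam * weak_rhs q u (picone_test e u zeta)].
Proof.
move=> e0 eu tz fz; have [ap _ _ _] := eu; have mu := approx_meas ap.
have [M M0 zM] := test_function_bounded tz.
have mz := test_function_measurable tz.
have iz := test_function_Lq q1 Omega_bounded tz.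
have [teta _ aeta _] := approx_abs q1 ap.
set eta := abs_approx phi in teta aeta.
have d0 n : 0 < n.+1%:R^-1 :> R by rewrite invr_gt0.
have eta0 n x : 0 <= eta n x by exact: smooth_abs_ge0.
have F0 n x : 0 < e + eta n x by rewrite ltr_pwDl.
have Fe n x : e <= e + eta n x by rewrite lerDl.
pose C := 2 * M / e + M ^+ 2 / e ^+ 2.
have C0 : 0 <= C by rewrite addr_ge0// divr_ge0 ?sqr_ge0 ?mulr_ge0// ltW.
pose psi n x := zeta x * zeta x * (e + eta n x)^-1.
apply: (eig_weak_limit q1 q2 (psi_ := psi) (C := C) eu fz iz C0).
- move=> n; apply: (test_function_support tz); last by move=> x zx; rewrite /psi zx !mul0r.
  have sz : smooth zeta by case: tz.
  apply: smoothM; first exact: smoothM.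
  apply: smoothV => //; apply: smoothD; first exact: smooth_cst.
  by case: (teta n).
- apply: measurable_funM; first exact: measurable_funM.
  apply: measurable_inv_pos; last by move=> x; rewrite addr_ge0// ltW.
  by apply: measurable_funD => //; exact: measurableT_comp.
- apply: filterS aeta => x hx; apply: cvgMr; apply: cvgV.
    by rewrite lt0r_neq0// ltr_pwDl.
  by apply: cvgD => //; exact: cvg_cst.
- move=> n x y; apply: le_trans (square_quotient_lip e0 (zM x) (zM y) (Fe n x) (Fe n y)) _.
  apply: ler_wpM2l => //; apply: lerD => //.
  rewrite (_ : e + eta n x - (e + eta n y) = eta n x - eta n y); last by ring.
  exact: smooth_abs_lip.
- move=> n x; apply: (@le_trans _ _ (C * `|zeta x|)); last by apply: ler_wpM2l; rewrite // lerDl.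
  rewrite /psi -mulrA normrM mulrC; apply: ler_wpM2r => //.
  rewrite normrM [`|(_)^-1|]ger0_norm ?invr_ge0 ?(ltW (F0 n x))//.
  apply: (@le_trans _ _ (M / e)).
    by apply: ler_pM; rewrite ?invr_ge0 ?(ltW (F0 n x))// lef_pV2 ?posrE.
  have : 0 <= M / e by rewrite divr_ge0// ltW.
  have : 0 <= M ^+ 2 / e ^+ 2 by rewrite divr_ge0// sqr_ge0.
  by rewrite /C -mulrA => ? ?; lra.
Qed.

Lemma neg_part0 u x : neg_part u x = 0 -> 0 <= u x.
Proof. by move=> h; rewrite (partsE u) h subr0 pos_part_ge0. Qed.

(* A strong minimum principle, from the remainder in Picone's inequality: the part carrying
   the factor (2e)^-1 blows up as e -> 0 unless zeta vanishes where u does. *)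
Lemma eig_strong_minimum lam u phi zeta : eigf lam u phi -> 0 < lam ->
  {ae leb, forall x, neg_part u x = 0} ->
  test_function Omega zeta -> fe zeta ->
  {ae leb, forall x, u x = 0 -> zeta x = 0}.
Proof.
move=> eu lam0 nu tz fz; have [ap _ _ _] := eu; have mu := approx_meas ap.
have mz := test_function_measurable tz.
have [k k0 hk] := kernel_lb_bounded N0 s0 Omega_bounded.
have [r r0 Or] := bounded_sub_cube Omega_bounded.
have [r' r'0 Hr'] := bounded_measure_poincare N0 Omega_bounded.
have [iz2 _] : Rintegrable leb (fun x => zeta x ^+ 2) /\
    @poincare_cst R N s r' * \int[leb]_x (zeta x ^+ 2) <= en zeta zeta.
  apply: poincare_real => //; apply: Hr'; first exact: measurable_nonzero.
  by move=> x /= zx; apply: contrapT => /(test_function_out tz) z0; rewrite z0 eqxx in zx.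
have mc := @measurable_cube R N 0 r.
have fc : (leb (cube 0 r) < +oo)%E by rewrite (lebesgue_cube _ (ltW r0)) ltry.
have ic : Rintegrable leb (\1_(cube 0 r) : V -> R) by exact: Rintegrable_indic.
have iau := Rintegrable_norm (eig_L1 q1 Omega_bounded eu).
(* [Z] is zeta^2 on the zero set of u; the claim is that its integral [Zi] vanishes. *)
pose Z0 := ~` [set x | u x != 0].
have mZ0 : measurable Z0 by apply: measurableC; exact: measurable_nonzero.
pose Z x : R := zeta x ^+ 2 * \1_Z0 x.
have Z_ge0 x : 0 <= Z x by rewrite mulr_ge0 ?sqr_ge0.
have iZ : Rintegrable leb Z.
  apply: (Rintegrable_le _ iz2).
    by apply: measurable_funM; [exact: measurable_funX|exact: measurable_indic].
  move=> x; rewrite ger0_norm// /Z indicE.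
  by case: (x \in Z0); rewrite ?mulr1 ?mulr0 ?sqr_ge0.
have ind0 (B : set V) x : 0 <= (\1_B x : R) by rewrite indicE.
have [iP PE] := Rintegrable_prod iau iZ (fun x => normr_ge0 (u x)) Z_ge0.
have [iQ QE] := Rintegrable_prod iz2 ic (fun x => sqr_ge0 (zeta x)) (ind0 _).
pose A := \int[leb]_x `|u x|.
pose B := \int[leb]_x zeta x ^+ 2.
pose m := \int[leb]_x (\1_(cube 0 r) x : R).
pose Zi := \int[leb]_x Z x.
have A0 : 0 < A.
  have [c c0 Hc] := eig_L1_lower N0 s0 q1 q2 Omega_bounded lam0.
  exact: lt_le_trans c0 (Hc _ _ _ (lexx lam) eu).
(* For u(x) > 0 = u(y), [picone_zero] leaves a gain u(x) zeta(y)^2 / (2e) against zeta(x)^2; the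
   bound k on the kernel turns it into products of integrals. The right-hand side does not depend on
   e. *)
have key (e : R) : 0 < e -> k * ((2 * e)^-1 * (A * Zi) - B * m) <= en zeta zeta.
  move=> e0; have [ig iw E] := eig_picone_test e0 eu tz fz.
  set psi := picone_test e u zeta in ig iw E.
  have W0 : 0 <= weak_rhs q u psi.
    have <- : \int[leb]_x (cst (0 : R) x) = 0 by rewrite /Rintegral /= integral0.
    apply: ae_Rint_le => //; first exact: integrable0.
    apply: filterS nu => x /neg_part0 ux; rewrite mulr_ge0//.
      by rewrite mulr_ge0 ?powR_ge0.
    by rewrite mulr_ge0 ?invr_ge0 ?addr_ge0 ?(ltW e0)// -expr2 sqr_ge0.
  have en0 : 0 <= en u psi by rewrite E mulr_ge0// ltW.
  apply: (@le_trans _ _ (en u psi + k * ((2 * e)^-1 * (A * Zi) - B * m))).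
    by rewrite lerDr.
  have iPQ := RintegrableB (RintegrableZ (2 * e)^-1 iP) iQ.
  rewrite /A /B /m /Zi -PE -QE -(Rint_Z _ iP) -(Rint_B (RintegrableZ _ iP) iQ).
  rewrite -(Rint_Z k iPQ) -(Rint_D ig (RintegrableZ k iPQ)).
  apply: ae_Rint_le => //; first exact: (RintegrableD ig (RintegrableZ k iPQ)).
  apply: filterS2 (ae_fst nu) (ae_snd nu) => -[x y] /= /neg_part0 ux /neg_part0 uy.
  have K0 := gagliardo_kernel_ge0 s (x, y).
  rewrite /gagliardo_integrand /psi /picone_test /Z /= (ger0_norm ux) (ger0_norm uy).
  have pic := picone (zeta x) (zeta y) ux uy e0.
  have base : (u x - u y) * (zeta x * zeta x * (e + u x)^-1 - zeta y * zeta y * (e + u y)^-1) *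
      gagliardo_kernel s (x, y) <=
      (zeta x - zeta y) * (zeta x - zeta y) * gagliardo_kernel s (x, y).
    exact: ler_wpM2r.
  (* Where the extra term is nonpositive, Picone's inequality alone is enough. *)
  have trivial_case : (2 * e)^-1 * (u x * (zeta y ^+ 2 * \1_Z0 y)) <=
      zeta x ^+ 2 * \1_(cube 0 r) y ->
    (u x - u y) * (zeta x * zeta x * (e + u x)^-1 - zeta y * zeta y * (e + u y)^-1) *
    gagliardo_kernel s (x, y) +
    k * ((2 * e)^-1 * (u x * (zeta y ^+ 2 * \1_Z0 y)) - zeta x ^+ 2 * \1_(cube 0 r) y) <=
      (zeta x - zeta y) * (zeta x - zeta y) * gagliardo_kernel s (x, y).
    move=> h; apply: le_trans base; rewrite gerDl pmulr_rle0// subr_le0//.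
  have zc0 : 0 <= zeta x ^+ 2 * \1_(cube 0 r) y by rewrite mulr_ge0 ?sqr_ge0.
  have [ux0|uxn0] := eqVneq (u x) 0.
    by apply: trivial_case; rewrite ux0 mul0r mulr0.
  have [zy0|zyn0] := eqVneq (zeta y) 0.
    by apply: trivial_case; rewrite zy0 expr0n mul0r !mulr0.
  have [uy0|uyn0] := eqVneq (u y) 0; last first.
    have i0 : \1_Z0 y = 0 :> R by rewrite indicE memNset// => /(_ uyn0).
    by apply: trivial_case; rewrite i0 !mulr0.
  have Ox : Omega x by apply: contrapT => /(approx_out ap) h; rewrite h eqxx in uxn0.
  have Oy : Omega y by apply: contrapT => /(test_function_out tz) h; rewrite h eqxx in zyn0.
  have xy : x != y by apply: contra_neq uxn0 => ->.
  have i1 : \1_Z0 y = 1 :> R by rewrite indicE mem_set// /Z0 /= uy0 eqxx.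
  have i2 : \1_(cube 0 r) y = 1 :> R by rewrite indicE mem_set//; exact: Or.
  rewrite uy0 i1 i2 !mulr1.
  have pz := picone_zero (zeta x) (zeta y) ux e0.
  rewrite uy0 in pic.
  have kK := hk _ _ Ox Oy xy.
  set K := gagliardo_kernel s (x, y) in K0 kK *.
  set T1 := (u x - 0) * _ in pz pic *.
  set T2 := (2 * e)^-1 * u x * zeta y ^+ 2 - zeta x ^+ 2 in pz.
  rewrite (_ : (2 * e)^-1 * (u x * zeta y ^+ 2) - zeta x ^+ 2 = T2); last by rewrite /T2 mulrA.
  have S0 : 0 <= (zeta x - zeta y) * (zeta x - zeta y) by rewrite -expr2 sqr_ge0.
  (* If T2 > 0, then k T2 <= K T2, and T1 + T2 <= 0 by [picone_zero]. *)
  have h1 : T1 * K + k * T2 <= 0 \/ T2 <= 0.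
    have [T20|T20] := leP T2 0; [by right|left].
    apply: (@le_trans _ _ ((T1 + T2) * K)); last by rewrite mulr_le0_ge0.
    by rewrite mulrDl lerD2l mulrC ler_wpM2l// ltW.
  case: h1 => h1; first by apply: le_trans h1 _; rewrite mulr_ge0.
  apply: (@le_trans _ _ (T1 * K)); first by rewrite gerDl pmulr_rle0.
  exact: ler_wpM2r.
have Zi0 : Zi <= 0.
  rewrite leNgt; apply/negP => Zi0.
  have B0 : 0 <= B by apply: Rintegral_ge0 => x _; exact: sqr_ge0.
  have m0 : 0 <= m by apply: Rintegral_ge0 => x _; exact: ind0.
  pose D := en zeta zeta + k * (B * m).
  have D0 : 0 <= D by rewrite addr_ge0 ?energy_ge0// !mulr_ge0// ltW.
  have D1 : 0 < D + 1 by rewrite ltr_wpDl.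
  (* This makes the gain equal to 2(D + 1), whereas [key] bounds it by D. *)
  pose e := k * (A * Zi) / (4 * (D + 1)).
  have AZ0 : 0 < k * (A * Zi) by rewrite !mulr_gt0.
  have e0 : 0 < e by rewrite divr_gt0// mulr_gt0.
  have := key _ e0.
  have -> : k * ((2 * e)^-1 * (A * Zi) - B * m) = 2 * (D + 1) - k * (B * m).
    by rewrite /e; field; rewrite !lt0r_neq0.
  by rewrite /D in D0 D1 *; lra.
have := Rint_eq0 iZ Z_ge0 Zi0; apply: filterS => x Zx ux.
move: Zx; rewrite /Z indicE mem_set ?mulr1; last by rewrite /Z0 /= ux eqxx.
by move/eqP; rewrite sqrf_eq0 => /eqP.
Qed.

(** Picone's inequality and Fatou's lemma as e -> 0 bound the integral of u^(q-2) zeta^2 by [zeta]^2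
    / lam. The Young coefficients q/2 and 1 - q/2 add up to 1, so equal normalizations force that
    integral to be at least 1. *)
Lemma nonneg_eig_le_energy lam u phi zeta : eigf lam u phi -> 0 < lam ->
  {ae leb, forall x, neg_part u x = 0} ->
  test_function Omega zeta -> fe zeta -> \int[leb]_x Lq zeta x = 1 ->
  lam <= en zeta zeta.
Proof.
move=> eu lam0 nu tz fz nz; have [ap nu1 _ _] := eu; have mu := approx_meas ap.
have mz := test_function_measurable tz.
have zu0 := eig_strong_minimum eu lam0 nu tz fz.
have d0 n : 0 < n.+1%:R^-1 :> R by rewrite invr_gt0.
have dl : (fun n => n.+1%:R^-1 : R) @ \oo --> (0 : R) by exact: cvg_harmonic.
pose h_ n x : R := `| `|u x| `^ (q - 2) * u x * picone_test n.+1%:R^-1 u zeta x|.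
(* By convention [h] is 0 where u vanishes, so the pointwise Young inequality holds there only
   because [zu0] makes zeta vanish too. *)
pose h x : R := `|u x| `^ (q - 2) * `|u x| * (zeta x ^+ 2 / `|u x|).
have iau := Rintegrable_norm (eig_L1 q1 Omega_bounded eu).
have ih_ n : Rintegrable leb (h_ n).
  by have [_ iw _] := eig_picone_test (d0 n) eu tz fz; exact: Rintegrable_norm.
have hE n x : h_ n x = `|u x| `^ (q - 2) * `|u x| * (zeta x ^+ 2 / (n.+1%:R^-1 + `|u x|)).
  rewrite /h_ normrM normrM (ger0_norm (powR_ge0 _ _)) /picone_test -expr2.
  by rewrite (ger0_norm (divr_ge0 (sqr_ge0 _) (addr_ge0 (ltW (d0 n)) (normr_ge0 _)))).
have Ch n : \int[leb]_x h_ n x <= en zeta zeta / lam.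
  have [ig iw E] := eig_picone_test (d0 n) eu tz fz.
  have -> : \int[leb]_x h_ n x = weak_rhs q u (picone_test n.+1%:R^-1 u zeta).
    apply: (ae_Rintegrable iw (Rintegrable_measurable (ih_ n)) _).2.
    apply: filterS nu => x /neg_part0 ux; apply/esym/ger0_norm; apply: mulr_ge0.
      by rewrite mulr_ge0 ?powR_ge0.
    by rewrite mulr_ge0 ?invr_ge0 ?addr_ge0 ?(ltW (d0 n))// -expr2 sqr_ge0.
  rewrite ler_pdivlMr// mulrC -E; apply: ae_Rint_le => //.
  apply: filterS2 (ae_fst nu) (ae_snd nu) => -[x y] /= /neg_part0 ux /neg_part0 uy.
  rewrite /gagliardo_integrand /picone_test /= (ger0_norm ux) (ger0_norm uy).
  by apply: ler_wpM2r; [exact: gagliardo_kernel_ge0|exact: picone].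
have mh : measurable_fun setT h.
  have mau : measurable_fun setT (fun x => `|u x|) by exact: measurableT_comp.
  apply: measurable_funM.
    by apply: measurable_funM => //; exact: (measurableT_comp (measurable_powR _) mau).
  by apply: measurable_funM; [exact: measurable_funX|exact: measurable_inv_pos].
have [ih Ih] : Rintegrable leb h /\ \int[leb]_x h x <= en zeta zeta / lam.
  apply: (Rfatou ih_) => //.
  - by move=> n x; exact: normr_ge0.
  - apply: aeW => x; under eq_fun do rewrite hE.
    rewrite /h; have [u0|un0] := eqVneq (u x) 0.
      by rewrite u0 normr0 mulr0 mul0r; under eq_fun do rewrite mul0r; exact: cvg_cst.
    apply: cvgMr; apply: cvgMr; apply: cvgV; first by rewrite normr_eq0.
    rewrite -[X in _ --> X]add0r; apply: cvgD => //; exact: cvg_cst.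
  - move=> x; apply: mulr_ge0; first by rewrite mulr_ge0 ?powR_ge0.
    by rewrite divr_ge0 ?sqr_ge0.
  - exact: nearW.
have iz := test_function_Lq q1 Omega_bounded tz.
have young : \int[leb]_x Lq zeta x <=
    q / 2 * \int[leb]_x h x + (1 - q / 2) * \int[leb]_x Lq u x.
  rewrite -(Rint_Z _ ih) -(Rint_Z _ (approx_Lq ap)) -Rint_D; last 2 first.
  - exact: RintegrableZ.
  - exact: (RintegrableZ _ (approx_Lq ap)).
  apply: ae_Rint_le => //.
    by apply: RintegrableD; [exact: RintegrableZ|exact: (RintegrableZ _ (approx_Lq ap))].
  apply: filterS zu0 => x zx; rewrite /abs_pow /h.
  have [u0|un0] := eqVneq (u x) 0.
    by rewrite zx// u0 !normr0 (powR0 qn0) expr0n !mul0r !mulr0 addr0.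
  rewrite -(real_normK (num_real (zeta x))).
  by apply: powR_young => //; rewrite normr_gt0.
have qp : 0 < q / 2 by rewrite divr_gt0.
have I1 : 1 <= \int[leb]_x h x.
  rewrite -(ler_pM2l qp) mulr1; move: young; rewrite nz nu1 mulr1; lra.
by have := le_trans I1 Ih; rewrite ler_pdivlMr// mul1r.
Qed.

End nonnegative_eigenfunctions.

(** Competitors of infinite energy satisfy the bound trivially, so only those of finite energy have
    to be examined. *)
Lemma lambda1_lower_bound {R : realType} {N : nat} (s q lam : R) (Omega : set 'rV[R]_N) :
  1 < q -> bounded_set Omega ->
  (forall zeta, test_function Omega zeta -> finite_energy s zeta ->
    \int[@lebesgue_rV R N]_x abs_pow q zeta x = 1 -> lam <= energy s zeta zeta) ->
  (lam%:E <= lambda1 Omega s q)%E.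
Proof.
move=> q1 Omega_bounded h; apply: le_ereal_inf_tmp => _ [zeta [tz nz] <-].
have [fin|] := ltP (gagliardo_sq s zeta) +oo%E; last by apply: le_trans; exact: leey.
have fz : finite_energy s zeta by apply: finite_energyP fin; exact: test_function_measurable tz.
rewrite gagliardo_sqE// lee_fin; apply: h => //.
move: nz; rewrite integral_out; last first.
  by move=> x Ox; rewrite (test_function_out tz Ox) normr0 powR0// lt0r_neq0// (lt_trans ltr01).
by rewrite (Rintegral_fineK (test_function_Lq q1 Omega_bounded tz)) => -[].
Qed.

Theorem theorem2 (R : realType) (N : nat) (s q : R) (Omega : set 'rV[R]_N)
    (hN : (1 <= N)%N) (hs : 0 < s < 1) (hq : 1 < q < 2)
    (Omega_open : open Omega) (Omega_bounded : bounded_set Omega)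
    (Omega_C11 : C11_boundary Omega) :
  ~ exists lam : nat -> R,
      [/\ forall n, semilinear_eigenvalue Omega s q (lam n),
          forall n, (lam n)%:E <> lambda1 Omega s q
        & (lam n)%:E @[n --> \oo] --> lambda1 Omega s q].
Proof.
case/andP: hs hq => s0 _ /andP[q1 q2] [lam [eig ne clam]].
have lam0 n : 0 < lam n by case: (eig n).
have le1 n : (lambda1 Omega s q <= (lam n)%:E)%E.
  have [u [phi eu]] := semilinear_eigenfunction q1 q2 Omega_bounded (eig n).
  have hk x y : Omega x -> Omega y -> x != y -> 0 <= gagliardo_kernel s (x, y).
    by move=> *; exact: gagliardo_kernel_ge0.
  (* With k = 0 the gap inequality reduces to lambda_1 <= lam. *)
  have := eig_gap q1 Omega_bounded (lexx 0) hk eu.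
  by rewrite mulr0 mul0r adde0.
have l0 : (0 <= lambda1 Omega s q)%E.
  apply: le_ereal_inf_tmp => _ [zeta _ <-]; apply: integral_ge0 => z _.
  by rewrite lee_fin mulr_ge0 ?sqr_ge0// invr_ge0 powR_ge0.
have lfin : lambda1 Omega s q \is a fin_num.
  by rewrite ge0_fin_numE//; apply: le_lt_trans (le1 0%N) (ltry _).
pose l := fine (lambda1 Omega s q).
have lE : lambda1 Omega s q = l%:E by rewrite fineK.
have L0 : 0 < l + 1 by rewrite ltr_pwDr// fine_ge0.
(* [d] is uniform over the eigenvalues at most l + 1, so one term of the sequence close enough to
   the limit gives the contradiction. *)
have [d d0 Hd] := eig_constant_sign hN s0 q1 q2 Omega_bounded L0.
have cl : lam @ \oo --> l by apply: (@fine_cvg _ _ _ _ (EFin \o lam)); rewrite -lE.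
have e0 : 0 < Num.min d 1 by rewrite lt_min d0 ltr01.
have [n hn] := cvg0_small (cvg_subC cl) e0.
have {hn} := hn n (leqnn n); rewrite lt_min => /andP[hd h1].
have lamL : lam n <= l + 1.
  by have := le_lt_trans (ler_norm _) h1; lra.
have lamd : ((lam n)%:E < lambda1 Omega s q + d%:E)%E.
  by rewrite lE -EFinD lte_fin; have := le_lt_trans (ler_norm _) hd; lra.
have [u [phi eu]] := semilinear_eigenfunction q1 q2 Omega_bounded (eig n).
have [u' [phi' [eu' nu']]] := Hd _ _ _ lamL lamd eu.
apply: (ne n); apply/eqP; rewrite eq_le le1 andbT.
apply: lambda1_lower_bound => // zeta tz fz nz.
exact: (nonneg_eig_le_energy hN s0 q1 q2 Omega_bounded eu' (lam0 n) nu' tz fz nz).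
Qed.
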